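(* A star transform $\mathcal{S}$ is invertible (i.e. injective on $C_c^2(S^2;D_1)$) if and only if it is not symmetric.
   Context: $D_1\subset\mathbb{R}^2$ is an open disc centered at the origin; $C_c^2(S^2;D_1)$ is the space of symmetric $2$-tensor fields on $\mathbb{R}^2$ with twice continuously differentiable components compactly supported in $D_1$. A symmetric $2$-tensor $g=(g_{ij})$ is identified with the vector $(g_{11},g_{12},g_{22})\in\mathbb{R}^3$; under this identification, for $a=(a_1,a_2)$ and $a^\perp=(-a_2,a_1)$: $a^2=(a_1^2,a_1a_2,a_2^2)$, $a\odot a^\perp=(-a_1a_2,\frac12(a_1^2-a_2^2),a_1a_2)$, $(a^\perp)^2=(a_2^2,-a_1a_2,a_1^2)$. The dot denotes the Euclidean dot product in $\mathbb{R}^3$. For a unit vector $a$, $\mathcal{X}_a h(x)=\int_0^\infty h(x+ta)\,dt$. Let $\gamma_1,\dots,\gamma_m$ ($m\ge1$) be distinct unit vectors in $\mathbb{R}^2$ and $c_1,\dots,c_m$ non-zero real constants. The star transform of $f$ with these branch directions and weights is the $\mathbb{R}^3$-valued function on $\mathbb{R}^2$ $$\mathcal{S}f=\sum_{i=1}^m c_i\,\mathcal{X}_{\gamma_i}\begin{bmatrix} f\cdot\gamma_i^2\\ f\cdot(\gamma_i\odot\gamma_i^\perp)\\ f\cdot(\gamma_i^\perp)^2\end{bmatrix}.$$ $\mathcal{S}$ is called symmetric if $m=2k$ for some $k\in\mathbb{N}$ and, after a possible rearrangement of indices, $\gamma_{i+k}=-\gamma_i$ and $c_{i+k}=c_i$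 for all $i=1,\dots,k$. *)

(* Defs.v *)
From mathcomp Require Import all_boot all_order all_algebra.
From mathcomp Require Import all_fingroup.
From mathcomp Require Import all_classical all_reals all_analysis.

Set Implicit Arguments.
Unset Strict Implicit.
Unset Printing Implicit Defensive.

Import Order.TTheory GRing.Theory Num.Theory.
Import numFieldNormedType.Exports.

Local Open Scope classical_set_scope.
Local Open Scope ring_scope.

Definition dotv (R : realType) (n : nat) (u v : 'rV[R]_n) : R :=
  \sum_(j < n) u 0 j * v 0 j.

(* The library norm on ['rV[R]_n] is the sup norm, hence this definition. *)
Definition enorm (R : realType) (n : nat) (u : 'rV[R]_n) : R :=
  Num.sqrt (dotv u u).

Definition disc (R : realType) (r : R) : set 'rV[R]_2 :=
  [set x | enorm x < r].

Definition vec3 (R : realType) (x y z : R) : 'rV[R]_3 :=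
  \row_(j < 3) [:: x; y; z]`_j.

Definition perp (R : realType) (a : 'rV[R]_2) : 'rV[R]_2 :=
  \row_(j < 2) [:: - a 0 1; a 0 0]`_j.

(* Symmetric 2-tensors g are represented by (g11, g12, g22), with the
   off-diagonal entry counted once; they are paired by the plain dot product
   of R^3, not the matrix inner product. *)
Definition tsq (R : realType) (a : 'rV[R]_2) : 'rV[R]_3 :=
  vec3 (a 0 0 ^+ 2) (a 0 0 * a 0 1) (a 0 1 ^+ 2).

(* The symmetrized product (a (x) b + b (x) a) / 2. *)
Definition todot (R : realType) (a b : 'rV[R]_2) : 'rV[R]_3 :=
  vec3 (a 0 0 * b 0 0) ((a 0 0 * b 0 1 + a 0 1 * b 0 0) / 2)
       (a 0 1 * b 0 1).

(* C^n in the sense that all partial derivatives up to order n exist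
   everywhere and are continuous. *)
Fixpoint Ck (R : realType) (n : nat) (h : 'rV[R]_2 -> R) : Prop :=
  continuous h /\
  if n is n'.+1 then
    forall i : 'I_2, (forall x, derivable h x (delta_mx 0 i)) /\
                     Ck n' (fun x => 'D_(delta_mx 0 i) h x)
  else True.

Definition compactly_supported_in (R : realType) (D : set 'rV[R]_2)
    (h : 'rV[R]_2 -> R) : Prop :=
  compact (closure [set x | h x != 0]) /\
  closure [set x | h x != 0] `<=` D.

Definition C2c_S2 (R : realType) (D : set 'rV[R]_2) :
    set ('rV[R]_2 -> 'rV[R]_3) :=
  [set f | forall j : 'I_3, Ck 2 (fun x => f x 0 j) /\
                            compactly_supported_in D (fun x => f x 0 j)].

Definition beam (R : realType) (a : 'rV[R]_2) (h : 'rV[R]_2 -> R)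
    (x : 'rV[R]_2) : R :=
  \int[lebesgue_measure]_(t in `[0, +oo[) h (x + t *: a).

Definition beamv (R : realType) (n : nat) (a : 'rV[R]_2)
    (F : 'rV[R]_2 -> 'rV[R]_n) (x : 'rV[R]_2) : 'rV[R]_n :=
  \row_(j < n) beam a (fun y => F y 0 j) x.

Definition star (R : realType) (m : nat) (gamma : 'I_m -> 'rV[R]_2)
    (c : 'I_m -> R) (f : 'rV[R]_2 -> 'rV[R]_3) : 'rV[R]_2 -> 'rV[R]_3 :=
  fun x => \sum_(i < m) c i *:
    beamv (gamma i)
      (fun y => vec3 (dotv (f y) (tsq (gamma i)))
                     (dotv (f y) (todot (gamma i) (perp (gamma i))))
                     (dotv (f y) (tsq (perp (gamma i))))) x.

(* The permutation [s] is the rearrangement of the indices; [lshift k i] and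
   [rshift k i] are the indices i and i + k. *)
Definition star_symmetric (R : realType) (m : nat)
    (gamma : 'I_m -> 'rV[R]_2) (c : 'I_m -> R) : Prop :=
  exists (k : nat) (km : (k + k)%N = m) (s : 'S_m), forall i : 'I_k,
    gamma (s (cast_ord km (rshift k i)))
      = - gamma (s (cast_ord km (lshift k i))) /\
    c (s (cast_ord km (rshift k i))) = c (s (cast_ord km (lshift k i))).

(* Main.v *)
Require Import Defs.
From mathcomp Require Import all_boot all_order all_algebra.
From mathcomp Require Import all_fingroup.
From mathcomp Require Import all_classical all_reals all_analysis.
From mathcomp Require Import ring lra.

Import Order.TTheory GRing.Theory Num.Theory.
Import numFieldNormedType.Exports.

Local Open Scope classical_set_scope.
Local Open Scope ring_scope.

(** Read in the frame (gamma_i, gamma_i^perp) of a branch, the trace of a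
    symmetric tensor is unchanged and its trace-free part (p, q), where
    p = f11 - f22 and q = f12, is rotated by twice the angle of gamma_i. So the
    sum of the first and last rows of the data is a scalar star transform of the
    trace with weights c_i, while their difference and twice the middle row form
    a star transform of (p, q) with c_i times that rotation as weights. Opposite
    branches have the same double-angle rotation, so for the trace and for (p, q)
    the same thing matters: whether opposite branches have equal c_i.

    In the symmetric case opposite half-lines join into full lines and every
    scalar transform is a combination of X-ray transforms in finitely many
    directions. The difference h(. + e gamma) - h has zero integral along every
    line parallel to gamma, and differences in other directions preserve this.
    Taking one difference for each branch of a C^2 bump gives a function h <> 0
    which all these transforms annihilate (lemma [exists_null_lines]), and the
    field h (1, 0, 1) is in the kernel.

    In the other case, let P(s) be the integral of a function over the line
    x + k y = s. By Fubini the half-line transform along gamma becomes a half-line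
    integral of P with speed d = gamma_1 + k gamma_2, that is
    (constant - primitive of P at s) / d. Hence vanishing data give
    sum_i (c_i / d_i) P_i(s) = 0, the constants being removed by s -> -oo
    (lemma [star_lineproj_eq0]). If the branch i_0 has no opposite branch of
    the same weight, then as the direction (1, k) becomes orthogonal to
    gamma_{i_0} the coefficient blows up like (c_{i_0} - c_j) / d_{i_0}, with c_j
    the weight of the opposite branch or 0, so it does not vanish for infinitely
    many k (lemma [generic_slopes]). For these k the integrals over lines vanish.

    It remains to see that G in C_c(R^2) vanishes when its integrals over the
    lines x + k y = s do, for infinitely many k (lemma [radon_inj]). The integral
    of G(x, y) (x + k y)^n is zero for these k and is a polynomial in k, hence all
    moments of G are zero. A continuous function of one variable with compact
    support and zero moments is zero (lemma [moments_eq0]), as one sees by testing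
    it against powers of a quadratic polynomial with a peak; applied in x and then
    in y this gives G = 0. *)

(** * Integrals of continuous functions with compact support *)

Section LineIntegrals.
Context {R : realType}.
Implicit Types (g k E : R -> R) (T : R).
Local Notation mu := (@lebesgue_measure R).

(** A support condition with an explicit radius: the integrals below are
    computed by evaluating primitives outside a ball of known radius. *)
Definition supp_in {V : normedModType R} T (h : V -> R) :=
  forall x, T < `|x| -> h x = 0.

Definition Ccball {V : normedModType R} T (h : V -> R) :=
  continuous h /\ supp_in T h.

Lemma supp_patch {T g} (D : set R) : supp_in T g -> [set x | `|x| <= T] `<=` D ->
  g \_ D = g.
Proof.
move=> sg TD; apply/funext => x; rewrite patchE; case: ifPn => //.
move=> /negP xD; rewrite sg// ltNge; apply/negP => xT; apply: xD.
by rewrite inE; apply: TD.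
Qed.

(** Lets a bounded interval, a half-line and the whole line be exchanged
    freely as domains of integration. *)
Lemma Rint_supp {T g} (D D' : set R) : supp_in T g ->
  (forall x, `|x| <= T -> D x <-> D' x) ->
  \int[mu]_(x in D) g x = \int[mu]_(x in D') g x.
Proof.
move=> sg DD'; rewrite Rintegral_mkcond [RHS]Rintegral_mkcond; congr Rintegral.
apply/funext => x; rewrite !patchE; have [xT|/sg->] := leP `|x| T; last first.
  by do 2 case: ifP.
by rewrite (_ : (x \in D) = (x \in D'))//; apply/idP/idP; rewrite !inE => /DD'; exact.
Qed.

Lemma Ccball_integrable {T g} (D : set R) : measurable D -> Ccball T g ->
  mu.-integrable D (EFin \o g).
Proof.
move=> mD [cg sg]; apply: (@integrableS _ _ _ mu setT) => //.
have -> : EFin \o g = (EFin \o g) \_ `[- T, T].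
  rewrite -[in LHS](@supp_patch _ g `[- T, T]%classic sg) ?restrict_EFin// => x /=.
  by rewrite in_itv/= ler_norml.
apply/(integrable_mkcond _ _).1 => //.
apply: continuous_compact_integrable; first exact: segment_compact.
exact: continuous_subspaceT.
Qed.

Definition primitive g x := \int[mu]_(t in `]-oo, x]) g t.

Lemma primitive_derive {T g} : Ccball T g -> forall x : R, is_derive x 1 (primitive g) (g x).
Proof.
move=> cg x; have [||||] := @continuous_FTC1 R g -oo%O x (x + 1).
- by rewrite ltrDl.
- exact: (Ccball_integrable _ _ cg).
- exact: ltNyr.
- exact: cg.1.
by move=> dF <-; rewrite derive1E; exact: derivableP.
Qed.

Lemma primitive_left {T g} x : supp_in T g -> x < - T -> primitive g x = 0.
Proof.
move=> sg xT; rewrite /primitive (Rint_supp _ set0 sg) ?Rintegral_set0// => t tT.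
split=> //=; rewrite in_itv/= => tx.
have := le_lt_trans tx xT; rewrite ltNge => /negP; apply.
by move: tT; rewrite ler_norml => /andP[].
Qed.

Lemma primitive_right {T g} x : supp_in T g -> T <= x ->
  primitive g x = \int[mu]_t g t.
Proof.
move=> sg xT; apply: (Rint_supp _ _ sg) => t tT.
split=> //= _; rewrite in_itv/=; apply: le_trans xT.
by move: tT; rewrite ler_norml => /andP[].
Qed.

Lemma primitive_unique {T g} E : Ccball T g -> (forall x : R, is_derive x 1 E (g x)) ->
  forall a b, primitive g b - primitive g a = E b - E a.
Proof.
move=> cg dE a b; have h (x : R) : is_derive x 1 (fun x => primitive g x - E x) 0.
  by apply: is_derive_eq (is_deriveB (primitive_derive cg x) (dE x)) _; rewrite subrr.
have := is_derive_0_is_cst a b h; lra.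
Qed.

Lemma Ccball_comp_aff {T g} (c d : R) : d != 0 -> Ccball T g ->
  Ccball ((T + `|c|) / `|d|) (fun t : R => g (c + t * d)).
Proof.
move=> d0 [cg sg]; split=> [t|t].
  apply: (@continuous_comp R R R (fun t => c + t * d) g t); last exact: cg.
  by apply: cvgD; [exact: cvg_cst|apply: cvgMl; exact: cvg_id].
rewrite ltr_pdivrMr ?normr_gt0// -normrM => h; apply: sg.
have := ler_normB (c + t * d) c; rewrite addrAC subrr add0r; lra.
Qed.

Lemma primitive_aff_derive {T g} (c d : R) : Ccball T g ->
  forall t : R, is_derive t 1 (fun t : R => primitive g (c + t * d)) (g (c + t * d) * d).
Proof.
move=> cg t; have da : is_derive t 1 (fun t : R => c + t * d) d.
  apply: is_derive_eq (is_deriveD (is_derive_cst c t (1:R))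
    (is_deriveM (is_derive_id t (1:R)) (is_derive_cst d t (1:R)))) _.
  by rewrite /= scaler0 !add0r /GRing.scale/= mulr1.
exact: (@is_derive1_comp R (primitive g) _ t _ _ (primitive_derive cg (c + t * d)) da).
Qed.

Lemma Rint_half {T g} : Ccball T g ->
  \int[mu]_(t in `[0, +oo[) g t = \int[mu]_t g t - primitive g 0.
Proof.
move=> cg; rewrite -Rintegral_itv_obnd_cbnd; last exact: (Ccball_integrable _ _ cg).
rewrite -(@Rintegral_itvB R g -oo%O +oo%O 0)//; last exact: (Ccball_integrable _ _ cg).
by congr (_ - _); apply: (Rint_supp _ _ cg.2).
Qed.

(** The affine substitution [t -> s + t * d], done with primitives: the lower
    end contributes [primitive k s], and the upper end is at +oo or -oo
    according to the sign of [d]. The dependence on [s] is the same for both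
    signs. *)
Lemma Rint_half_line {T k} (s d : R) : Ccball T k -> d != 0 ->
  \int[mu]_(t in `[0, +oo[) k (s + t * d) =
  ((if 0 < d then \int[mu]_t k t else 0) - primitive k s) / d.
Proof.
move=> ck d0; have cg := Ccball_comp_aff s d d0 ck.
set T' := (T + _) / _ in cg; pose U := Num.max T' ((`|T| + `|s| + 1) / `|d|).
rewrite (Rint_half cg) -(primitive_right U cg.2) ?le_max ?lexx//.
have dE (t : R) : is_derive t 1 (fun t : R => d^-1 * primitive k (s + t * d)) (k (s + t * d)).
  apply: is_derive_eq (is_deriveZ d^-1 (primitive_aff_derive s d ck t)) _.
  by rewrite /GRing.scale/= mulrCA mulVf// mulr1.
rewrite (primitive_unique _ cg dE) mul0r addr0 -mulrBr mulrC; congr ((_ - _) / _).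
have Ud : `|T| + `|s| + 1 <= U * `|d|.
  by rewrite -ler_pdivrMr ?normr_gt0// /U le_max lexx orbT.
have := ler_norm T; have := ler_norm (- T); rewrite normrN.
have := ler_norm s; have := ler_norm (- s); rewrite normrN.
case: ltP => dp.
  by rewrite (gtr0_norm dp) in Ud => *; rewrite (primitive_right _ ck.2)//; lra.
by rewrite (ler0_norm dp) in Ud => *; rewrite (primitive_left _ ck.2)//; lra.
Qed.

(** Both sides are increments of [primitive g], over intervals that contain the
    support. *)
Lemma Rint_shift {T g} (c : R) : Ccball T g ->
  \int[mu]_t g (t + c) = \int[mu]_t g t.
Proof.
move=> cg; have cg' := Ccball_comp_aff c 1 (oner_neq0 R) cg.
set T' := (T + _) / _ in cg'; pose U := `|T| + `|c| + `|T'| + 1.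
have -> : (fun t => g (t + c)) = (fun t => g (c + t * 1)).
  by apply/funext => t; rewrite mulr1 addrC.
have := ler_norm T; have := ler_norm (- T); rewrite normrN.
have := ler_norm c; have := ler_norm (- c); rewrite normrN.
have := ler_norm T'; have := ler_norm (- T'); rewrite normrN => *.
have dE (t : R) : is_derive t 1 (fun t : R => primitive g (c + t * 1)) (g (c + t * 1)).
  by apply: is_derive_eq (primitive_aff_derive c 1 cg t) _; rewrite mulr1.
have := primitive_unique _ cg' dE (- U) U.
rewrite (primitive_left (- U) cg'.2) ?(primitive_right U cg'.2)//; try by rewrite /U; lra.
rewrite (primitive_left (c + - U * 1) cg.2); last by rewrite /U; lra.
by rewrite (primitive_right (c + U * 1) cg.2) ?subr0//; rewrite /U; lra.
Qed.

Lemma primitive_eq0 {T g} : Ccball T g -> (forall x, primitive g x = 0) -> g = cst 0.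
Proof.
move=> cg p0; apply/funext => x; have := primitive_derive cg x.
have -> : primitive g = cst 0 by apply/funext.
by move=> d0; rewrite -(@derive_val _ _ _ _ _ _ _ d0) derive_cst.
Qed.

Lemma CcballD {V : normedModType R} {T} {f g : V -> R} : Ccball T f -> Ccball T g ->
  Ccball T (fun x => f x + g x).
Proof.
move=> [cf sf] [cg sg]; split=> [x|x xT]; last by rewrite sf// sg// addr0.
by apply: cvgD; [exact: cf|exact: cg].
Qed.

Lemma CcballM {V : normedModType R} {T} {f g : V -> R} : continuous f -> Ccball T g ->
  Ccball T (fun x => f x * g x).
Proof.
move=> cf [cg sg]; split=> [x|x xT]; last by rewrite sg// mulr0.
by apply: cvgM; [exact: cf|exact: cg].
Qed.

Lemma Ccball_le {V : normedModType R} {T T'} {g : V -> R} : T <= T' ->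
  Ccball T g -> Ccball T' g.
Proof. by move=> TT [cg sg]; split=> // x xT; apply: sg; apply: le_lt_trans xT. Qed.

Definition Cc {V : normedModType R} (g : V -> R) := exists T, Ccball T g.

Lemma CcD {V : normedModType R} {f g : V -> R} : Cc f -> Cc g ->
  Cc (fun x => f x + g x).
Proof.
move=> [T cf] [T' cg]; exists (Num.max T T').
by apply: CcballD; [apply: Ccball_le cf|apply: Ccball_le cg]; rewrite le_max lexx ?orbT.
Qed.

Lemma CcM {V : normedModType R} {f g : V -> R} : continuous f -> Cc g ->
  Cc (fun x => f x * g x).
Proof. by move=> cf [T cg]; exists T; exact: CcballM. Qed.

Lemma CcZ {V : normedModType R} {g : V -> R} c : Cc g -> Cc (fun x => c * g x).
Proof. by apply: CcM => x; exact: cvg_cst. Qed.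

Lemma CcB {V : normedModType R} {f g : V -> R} : Cc f -> Cc g ->
  Cc (fun x => f x - g x).
Proof.
move=> cf cg; have := CcD cf (CcZ (-1) cg).
by congr Cc; apply/funext => x; rewrite mulN1r.
Qed.

Lemma Cc_sum {V : normedModType R} {I : Type} (r : seq I) (c : I -> R)
    (F : I -> V -> R) :
  (forall i, Cc (F i)) -> Cc (fun x => \sum_(i <- r) c i * F i x).
Proof.
move=> cF; elim: r => [|i r IH].
  exists 0; split=> [x|x _]; last by rewrite big_nil.
  by under eq_fun do rewrite big_nil; exact: cvg_cst.
by under eq_fun do rewrite big_cons; apply: CcD => //; exact: CcZ.
Qed.

Lemma Cc_integrable {g} (D : set R) : measurable D -> Cc g ->
  mu.-integrable D (EFin \o g).
Proof. by move=> mD [T]; exact: Ccball_integrable. Qed.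

Lemma Rint_sum {I : Type} (D : set R) (r : seq I) (c : I -> R)
    (F : I -> R -> R) : measurable D -> (forall i, Cc (F i)) ->
  \int[mu]_(x in D) (\sum_(i <- r) c i * F i x) =
  \sum_(i <- r) c i * \int[mu]_(x in D) F i x.
Proof.
move=> mD cF; elim: r => [|i r IH].
  under eq_Rintegral do rewrite big_nil.
  by rewrite big_nil Rintegral_cst// mul0r.
under eq_Rintegral do rewrite big_cons.
rewrite RintegralD//; first by rewrite big_cons IH RintegralZl//; exact: Cc_integrable.
  by apply: Cc_integrable => //; exact: CcZ.
by apply: Cc_integrable => //; exact: Cc_sum.
Qed.

End LineIntegrals.

(** * Exchange of iterated integrals *)

Section Boxes.
Context {R : realType}.
Implicit Types (T M : R).
Local Notation mu := (@lebesgue_measure R).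

(** Separate continuity with a uniform bound is all that dominated convergence
    requires for the exchange of iterated integrals. *)
Definition box T M (g : R -> R -> R) :=
  [/\ forall x, Ccball T (g x), forall y, Ccball T (g ^~ y) & forall x y, `|g x y| <= M].

Lemma box_swap {T M} {g : R -> R -> R} : box T M g -> box T M (fun x y => g y x).
Proof. by case. Qed.

Lemma patch_integrable (A a b : R) :
  mu.-integrable setT (EFin \o (cst A \_ `[a, b]%classic)).
Proof.
rewrite -restrict_EFin; apply/(integrable_mkcond _ _).1 => //.
apply: continuous_compact_integrable; first exact: segment_compact.
by apply: continuous_subspaceT => x; exact: cvg_cst.
Qed.

(** The dominating function for the theorems on integrals with a parameter. *)
Lemma box_bound {T M} {g : R -> R -> R} D : box T M g -> measurable D ->
  let G := (cst M) \_ `[- T, T] in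
  [/\ mu.-integrable D (EFin \o G), forall y, 0 <= G y &
      forall x y, `|g x y| <= G y].
Proof.
move=> [cx cy gM] mD G; have M0 : 0 <= M by apply: le_trans (gM 0 0).
split=> [|y|x y].
- by apply: (@integrableS _ _ _ mu setT) => //; exact: patch_integrable.
- by rewrite /G patchE; case: ifP.
- rewrite /G patchE; case: ifPn => // /negP yT.
  rewrite (cx x).2 ?normr0// ltNge; apply/negP => yT'; apply: yT.
  by rewrite inE/= in_itv/= -ler_norml.
Qed.

Lemma box_int_Ccball {T M} {g : R -> R -> R} D : box T M g -> measurable D ->
  Ccball T (fun x => \int[mu]_(y in D) g x y).
Proof.
move=> bg mD; have [iG G0 gG] := box_bound D bg mD; have [cx cy gM] := bg.
split=> [x|x xT]; last first.
  by under eq_Rintegral do rewrite (cy _).2//; rewrite Rintegral_cst// mul0r.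
apply: (@continuity_under_integral R _ _ mu g D mD (x - 1) (x + 1) _ _ _ iG).
- by move=> z _; exact: Ccball_integrable.
- by apply: aeW => y _ z _; exact: (cy y).1.
- by move=> z _; apply: aeW => y _; exact: gG.
- by rewrite inE/= in_itv/=; apply/andP; split; lra.
Qed.

(** Fubini by differentiation: as functions of [s] both sides have derivative
    the integral of [g s] and vanish to the left of the support. *)
Lemma box_fubini_primitive {T M} {g : R -> R -> R} s : box T M g ->
  \int[mu]_y primitive (g ^~ y) s = primitive (fun x => \int[mu]_y g x y) s.
Proof.
move=> bg; have [iG G0 gG] := box_bound setT bg measurableT.
have [cx cy gM] := bg.
pose A s := \int[mu]_y primitive (g ^~ y) s.
have cB := box_int_Ccball setT bg measurableT.
have cA s' : Ccball T (fun y => primitive (g ^~ y) s').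
  exact: box_int_Ccball (box_swap bg) _.
have dA (a : R) : is_derive a 1 A (\int[mu]_y g a y).
  have Ia : a \in `]a - 1, a + 1[ by rewrite in_itv/=; apply/andP; split; lra.
  have d1 (x y : R) : is_derive x 1 (fun x : R => primitive (g ^~ y) x) (g x y).
    exact: primitive_derive (cy y) x.
  have [h1 h2 h3] : [/\ forall x : R, `]a - 1, a + 1[%classic x ->
       mu.-integrable setT (EFin \o (fun y => primitive (g ^~ y) x)),
     forall x y : R, `]a - 1, a + 1[%classic x -> setT y ->
       derivable (fun x : R => primitive (g ^~ y) x) x 1 &
     forall x y : R, `]a - 1, a + 1[%classic x -> setT y ->
      `|partial1of2 (fun x y => primitive (g ^~ y) x) x y| <= (cst M \_ `[- T, T]) y].
    split=> [x _|x y _ _|x y _ _]; first exact: (Ccball_integrable _ measurableT (cA x)).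
      by have [] := d1 x y.
    by rewrite partial1of2E (@derive_val _ _ _ _ _ _ _ (d1 x y)).
  have D := derivableP (derivable_under_integral measurableT Ia h1 h2 G0 iG h3).
  apply: is_derive_eq D _; rewrite -derive1E.
  rewrite (differentiation_under_integral measurableT Ia h1 h2 G0 iG h3).
  apply: eq_Rintegral => y _; rewrite partial1of2E.
  exact: (@derive_val _ _ _ _ _ _ _ (d1 a y)).
have e := primitive_unique _ cB dA (- T - 1) s.
move: e; rewrite (primitive_left (- T - 1) cB.2); last by rewrite ltrBlDr ltrDl.
rewrite subr0 => ->; rewrite /A.
suff -> : \int[mu]_y primitive (g ^~ y) (- T - 1) = 0 by rewrite subr0.
under eq_Rintegral do rewrite (primitive_left (- T - 1) (cy _).2) ?ltrBlDr ?ltrDl//.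
by rewrite Rintegral_cst// mul0r.
Qed.

Lemma box_fubini {T M} {g : R -> R -> R} : box T M g ->
  \int[mu]_y \int[mu]_x g x y = \int[mu]_x \int[mu]_y g x y.
Proof.
move=> bg; have [cx cy gM] := bg.
rewrite -(primitive_right T (box_int_Ccball setT bg measurableT).2)//.
rewrite -(box_fubini_primitive T bg); apply: eq_Rintegral => y _.
by rewrite (primitive_right _ (cy y).2).
Qed.

Lemma box_fubini_half {T M} {g : R -> R -> R} : box T M g ->
  \int[mu]_y \int[mu]_(x in `[0, +oo[) g x y =
  \int[mu]_(x in `[0, +oo[) \int[mu]_y g x y.
Proof.
move=> bg; have [cx cy gM] := bg; have bg' := box_swap bg.
rewrite (Rint_half (box_int_Ccball setT bg measurableT)) -(box_fubini_primitive 0 bg).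
rewrite -(box_fubini bg) -RintegralB//; last 2 first.
- by apply: (Ccball_integrable _ _ (box_int_Ccball _ bg' _)).
- by apply: (Ccball_integrable _ _ (box_int_Ccball _ bg' _)).
by apply: eq_Rintegral => y _; rewrite (Rint_half (cy y)).
Qed.

End Boxes.

(** * Functions with vanishing moments *)

Section Moments.
Context {R : realType}.
Implicit Types (g : R -> R).
Local Notation mu := (@lebesgue_measure R).

Lemma Ccball_bounded {V : normedModType R} {T} {h : V -> R} :
  compact [set x : V | `|x| <= T] -> Ccball T h -> exists M, forall x, `|h x| <= M.
Proof.
move=> cK [ch sh].
have /compact_bounded [M [Mr MP]] : compact (h @` [set x | `|x| <= T]).
  by apply: continuous_compact => //; exact: continuous_subspaceT.
exists (Num.max 0 (M + 1)) => x; have [xT|/sh->] := leP `|x| T; last first.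
  by rewrite normr0 le_max lexx.
rewrite le_max; apply/orP; right; apply: (MP (M + 1)); first by rewrite ltrDl.
by exists x.
Qed.

Lemma Rint_patch (A a b : R) : a <= b ->
  \int[mu]_x (cst A \_ `[a, b]%classic) x = A * (b - a).
Proof.
move=> ab; rewrite -Rintegral_mkcond Rintegral_cst//; congr (_ * _).
have := lebesgue_measure_itv `[a, b]; rewrite /= lte_fin => ->.
by move: ab; rewrite le_eqVlt => /orP[/eqP->|->//]; rewrite ltxx subrr.
Qed.

Lemma bernoulli_ineq (x : R) n : 0 <= x -> 1 + n%:R * x <= (1 + x) ^+ n.
Proof.
move=> x0; elim: n => [|n IH]; first by rewrite mul0r addr0 expr0.
rewrite exprS; apply: le_trans (ler_wpM2l _ IH); last lra.
by have : 0 <= n%:R :> R by []; rewrite -natr1; nra.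
Qed.

(** The class of functions with zero moments is stable under multiplication by
    polynomials; powers of a quadratic polynomial are the multipliers that the
    peak argument uses. *)
Lemma moments_quad {g} (a b c : R) (q := fun x => a + b * x + c * x ^+ 2) :
  Cc g -> (forall n, \int[mu]_x (x ^+ n * g x) = 0) ->
  forall n, Cc (fun x => q x ^+ n * g x) /\ \int[mu]_x (q x ^+ n * g x) = 0.
Proof.
move=> cg mg n.
have cX j : continuous (fun x : R => x ^+ j) by exact: exprn_continuous.
suff [cq /(_ 0%N) h] : Cc (fun x => q x ^+ n * g x) /\
    forall j, \int[mu]_x (x ^+ j * (q x ^+ n * g x)) = 0.
  split=> //; rewrite -[RHS]h; apply: eq_Rintegral => x _; by rewrite expr0 mul1r.
elim: n => [|n [cq IH]].
  have e x : q x ^+ 0 * g x = g x by rewrite expr0 mul1r.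
  split; first by under eq_fun do rewrite e.
  by move=> j; under eq_Rintegral do rewrite e.
pose u x := q x ^+ n * g x.
have e j x : x ^+ j * (q x ^+ n.+1 * g x) =
   \sum_(i < 3) [:: a; b; c]`_i * (x ^+ (j + i) * u x).
  by rewrite !big_ord_recl big_ord0 /= /bump /= /u /q !exprS !exprD; ring.
have cu (j : nat) (i : 'I_3) : Cc (fun x : R => x ^+ (j + i) * u x) by exact: CcM.
split.
  have -> : (fun x => q x ^+ n.+1 * g x) = (fun x => x ^+ 0 * (q x ^+ n.+1 * g x)).
    by apply/funext => x; rewrite expr0 mul1r.
  by under eq_fun do rewrite e; exact: Cc_sum.
move=> j; under eq_Rintegral do rewrite e.
rewrite (@Rint_sum _ _ setT _ _ (fun i x => x ^+ (j + nat_of_ord i) * u x))//.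
by apply: big1 => i _; rewrite IH mulr0.
Qed.

(** If [g p > 0], choose a quadratic polynomial [q] that is nonnegative on the
    support of [g], at most 1 outside a neighbourhood of [p] on which [g] is
    positive, and greater than 1 on a smaller neighbourhood. Then the integrals
    of [q ^ n * g] tend to +oo, whereas they are all zero. *)
Lemma moments_le0 {g} : Cc g -> (forall n, \int[mu]_x (x ^+ n * g x) = 0) ->
  forall p, g p <= 0.
Proof.
move=> Cg mg p; have [T cg] := Cg; rewrite leNgt; apply/negP => gp.
have pT : `|p| <= T by rewrite leNgt; apply/negP => /cg.2 e; rewrite e ltxx in gp.
have [C gC] : exists M, forall x, `|g x| <= M.
  apply: (Ccball_bounded _ cg).
  rewrite (_ : mkset _ = `[- T, T]%classic); first exact: segment_compact.
  by apply/seteqP; split => x /=; rewrite in_itv/= ler_norml.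
have C0 : 0 <= C by apply: le_trans (gC 0).
pose c := g p / 2; have c0 : 0 < c by rewrite divr_gt0.
have [d /= d0 dP] : \forall x \near p, c < g x.
  by apply: (cvgr_gt _ (cg.1 p)); rewrite /c; lra.
have gd x : `|x - p| < d -> c < g x by move=> ?; apply: dP => /=; rewrite distrC.
(* rho exceeds the diameter of the support; eta is chosen so that q is 1 at
   distance d from p *)
pose rho := 2 * T + 1; have rho0 : 0 < rho by have := normr_ge0 p; rewrite /rho; lra.
pose eta := (d / rho) ^+ 2; have eta0 : 0 < eta by rewrite exprn_gt0// divr_gt0.
pose q x := 1 + eta - ((x - p) / rho) ^+ 2.
(* the left-hand side bounds the negative part of the integral, the right-hand
   side is a lower bound, by Bernoulli's inequality, for what the peak adds *)
have [n nP] : exists n : nat, 2 * T * C < c * (1 + n%:R * (eta / 2)) * d.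
  have K1 := mulr_gt0 (mulr_gt0 c0 (divr_gt0 eta0 (ltr0Sn R 1))) d0.
  have K0 : 0 <= 2 * T * C / (c * (eta / 2) * d).
    have := normr_ge0 p => h; apply: divr_ge0; first by rewrite !mulr_ge0//; lra.
    exact: ltW.
  have := archi_boundP K0; set n := Num.bound _ => h; exists n.
  rewrite ltr_pdivrMr in h; last exact: K1.
  apply: lt_le_trans h _; have := mulr_gt0 c0 d0; lra.
have qE x : q x = (1 + eta - (p / rho) ^+ 2) + (2 * p / rho ^+ 2) * x
    + (- rho ^- 2) * x ^+ 2.
  by rewrite /q; field; rewrite gt_eqF.
have [cq Iq] := moments_quad (1 + eta - (p / rho) ^+ 2) (2 * p / rho ^+ 2)
  (- rho ^- 2) Cg mg n.
have {}cq : Cc (fun x => q x ^+ n * g x) by under eq_fun do rewrite qE.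
have {}Iq : \int[mu]_x (q x ^+ n * g x) = 0 by under eq_Rintegral do rewrite qE.
pose A := c * (1 + eta / 2) ^+ n.
pose f1 := cst A \_ `[p - d / 2, p + d / 2]%classic.
pose f2 := cst C \_ `[- T, T]%classic.
(* the product is at least A on the peak and at least - C on the support *)
have f1q (x : R) : f1 x - f2 x <= q x ^+ n * g x.
  have f20 : 0 <= f2 x by rewrite /f2 patchE; case: ifP.
  have sq (r : R) : `|x - p| <= r -> ((x - p) / rho) ^+ 2 <= (r / rho) ^+ 2.
    move=> xr; rewrite -[leLHS]real_normK ?num_real// ler_pXn2r ?nnegrE//.
      rewrite normrM normfV (gtr0_norm rho0) ler_wpM2r ?invr_ge0//.
      exact: ltW.
    by rewrite divr_ge0 ?(ltW rho0)//; apply: le_trans xr.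
  have A0 : 0 <= A by rewrite mulr_ge0 ?(ltW c0)// exprn_ge0//; lra.
  rewrite {1}/f1 patchE; case: ifPn => [|/negP xI].
    rewrite inE/= in_itv/= => /andP[x1 x2].
    have xd2 : `|x - p| <= d / 2 by rewrite ler_norml; apply/andP; split; lra.
    have := sq _ xd2; have -> : (d / 2 / rho) ^+ 2 = eta / 4.
      by rewrite /eta; field; rewrite gt_eqF.
    move=> q1; have gc : c < g x by apply: gd; apply: le_lt_trans xd2 _; lra.
    rewrite lerBlDr; apply: (@le_trans _ _ (q x ^+ n * g x)); last by rewrite lerDl.
    rewrite /A mulrC; apply: ler_pM; rewrite ?(ltW c0) ?(ltW gc)//.
      by rewrite exprn_ge0//; lra.
    by apply: lerXn2r; rewrite ?nnegrE /q; lra.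
  rewrite sub0r; have [xd|dx] := ltP `|x - p| d.
    apply: (@le_trans _ _ 0); first by rewrite oppr_le0.
    rewrite mulr_ge0//; last by apply/ltW/(lt_trans c0)/gd.
    by apply: exprn_ge0; have := sq _ (ltW xd); rewrite /q /eta; lra.
  have [xT|/cg.2->] := leP `|x| T; last by rewrite mulr0 oppr_le0.
  have -> : f2 x = C by rewrite /f2 patchE ifT// inE/= in_itv/= -ler_norml.
  have xpT : `|x - p| <= 2 * T by apply: le_trans (ler_normB _ _) _; lra.
  rewrite lerNl; apply: le_trans (ler_norm _) _; rewrite normrN normrM.
  rewrite -[leRHS]mul1r; apply: ler_pM => //; rewrite normrX.
  rewrite exprn_ile1 ?normr_ge0// ler_norml; apply/andP; split.
    have := sq _ xpT; have : (2 * T / rho) ^+ 2 <= 1.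
      rewrite expr_le1// ?divr_ge0 ?(ltW rho0)//; last by have := normr_ge0 p; lra.
      by rewrite ler_pdivrMr// /rho; lra.
    rewrite /q; lra.
  suff : eta <= ((x - p) / rho) ^+ 2 by rewrite /q; lra.
  rewrite -[leRHS]real_normK ?num_real// ler_pXn2r ?nnegrE ?divr_ge0 ?(ltW rho0) ?(ltW d0)//.
  rewrite normrM normfV (gtr0_norm rho0) ler_wpM2r ?invr_ge0//.
  exact: ltW.
have : \int[mu]_x (f1 x - f2 x) <= \int[mu]_x (q x ^+ n * g x).
  apply: le_Rintegral => //; last by apply: (Cc_integrable _ _ cq).
  have := integrableB measurableT (patch_integrable A (p - d / 2) (p + d / 2))
    (patch_integrable C (- T) T).
  by apply: eq_integrable => //.
rewrite Iq RintegralB//; try exact: patch_integrable.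
rewrite !Rint_patch; [|by have := normr_ge0 p; lra|lra].
have := bernoulli_ineq (eta / 2) n (ltW (divr_gt0 eta0 (ltr0Sn _ 1))).
rewrite -(ler_pM2l c0) -(ler_pM2r d0) -/A => B.
have -> : p + d / 2 - (p - d / 2) = d by field.
lra.
Qed.

Lemma moments_eq0 {g} : Cc g ->
  (forall n, \int[mu]_x (x ^+ n * g x) = 0) -> forall x, g x = 0.
Proof.
move=> cg mg x; apply/eqP; rewrite eq_le (moments_le0 cg mg)/=.
have e y : (-1) * g y = - g y by rewrite mulN1r.
rewrite -oppr_le0 -e; apply: (moments_le0 (CcZ (-1) cg)) => n.
have cX : continuous (fun x : R => x ^+ n) by exact: exprn_continuous.
under eq_Rintegral do rewrite mulrCA.
by rewrite RintegralZl// ?mg ?mulr0//; exact: (Cc_integrable _ _ (CcM cX cg)).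
Qed.

End Moments.

(** * Slopes at which the weights do not cancel *)

Section Slopes.
Context {R : realType}.
Implicit Types (v w : 'rV[R]_2).

Lemma rV2P v w : v 0 0 = w 0 0 -> v 0 1 = w 0 1 -> v = w.
Proof.
move=> h0 h1; apply/rowP => -[[|[|//]] jlt].
  by rewrite (_ : Ordinal jlt = 0)//; exact: val_inj.
by rewrite (_ : Ordinal jlt = 1)//; exact: val_inj.
Qed.

Lemma dotv2E v : dotv v v = v 0 0 ^+ 2 + v 0 1 ^+ 2.
Proof.
rewrite /dotv !big_ord_recl big_ord0 addr0 !expr2.
by congr (_ + v 0 _ * v 0 _); exact: val_inj.
Qed.

Lemma enorm1 v : enorm v = 1 -> v 0 0 ^+ 2 + v 0 1 ^+ 2 = 1.
Proof.
rewrite /enorm dotv2E => h; rewrite -[LHS]sqr_sqrtr; first by rewrite h expr1n.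
by rewrite addr_ge0// sqr_ge0.
Qed.

Lemma near_affine_neq0 (p q : R) : p ^+ 2 + q ^+ 2 = 1 ->
  \forall e \near 0^'+, p + e * q != 0.
Proof.
move=> pq; have [p0|p0] := eqVneq p 0.
  have q0 : q != 0.
    by apply: contra_eq_neq pq => ->; rewrite p0 expr0n/= addr0 eq_sym oner_neq0.
  near=> e; rewrite p0 add0r mulf_neq0// gt_eqF//.
have : (fun e => p + e * q) @ 0^'+ --> p + 0 * q.
  apply: cvg_at_right_filter; apply: cvgD; first exact: cvg_cst.
  exact: (cvgM cvg_id (cvg_cst q)).
by move/cvgr_neq0; apply; rewrite mul0r addr0.
Unshelve. all: by end_near. Qed.

(** The direction [(1, k)] is taken proportional to [v0^perp + e * v0] for small
    [e > 0], where [v0 = v i0]. Multiplied by [e], the sum tends to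
    [w i0 - w j] if [v j = - v0], and to [w i0] if there is no such [j]; the other
    branches contribute terms that tend to 0. Hence the sum is nonzero for all
    small [e], and distinct [e] give distinct slopes. *)
Lemma generic_slopes {m} {v : 'I_m -> 'rV[R]_2} {w : 'I_m -> R} {i0 : 'I_m} :
  (forall i, enorm (v i) = 1) -> injective v -> w i0 != 0 ->
  (forall j, v j = - v i0 -> w j != w i0) ->
  exists k : nat -> R, injective k /\ forall n,
    (forall i, v i 0 0 + k n * v i 0 1 != 0) /\
    \sum_(i < m) w i / (v i 0 0 + k n * v i 0 1) != 0.
Proof.
move=> v1 vI w0 wopp; set a := v i0 0 0; set b := v i0 0 1.
have ab : a ^+ 2 + b ^+ 2 = 1 by exact: enorm1.
(* p i and q i are the coordinates of v i along v0^perp and v0 *)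
pose p i := - b * v i 0 0 + a * v i 0 1.
pose q i := a * v i 0 0 + b * v i 0 1.
have pq i : p i ^+ 2 + q i ^+ 2 = 1.
  rewrite -[RHS](enorm1 _ (v1 i)) -[RHS]mul1r -ab /p /q; ring.
have vE i : v i 0 0 = a * q i - b * p i /\ v i 0 1 = b * q i + a * p i.
  by split; rewrite -[LHS]mul1r -ab /p /q; ring.
have pi0 : p i0 = 0 by rewrite /p -/a -/b; ring.
have qi0 : q i0 = 1 by rewrite /q -/a -/b -!expr2.
have p0E i : p i = 0 -> i = i0 \/ (v i = - v i0 /\ q i = -1).
  move=> pi; have [vi0 vi1] := vE i; rewrite pi !mulr0 subr0 addr0 in vi0 vi1.
  have := pq i; rewrite pi expr0n/= add0r => /eqP; rewrite sqrf_eq1.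
  case/orP => /eqP qi; [left; apply: vI|right; split => //];
    by apply: rV2P; rewrite ?mxE ?vi0 ?vi1 qi ?mulr1 ?mulrN1.
(* when p i = 0, q i is 1 or -1, so that 1 / q i = q i *)
pose l i := if p i == 0 then w i * q i else 0.
have lim : (fun e => \sum_(i < m) w i * (e / (p i + e * q i))) @ 0^'+ -->
    \sum_(i < m) l i.
  apply: cvg_big => [|i _]; first exact: add_continuous.
  rewrite /l; case: eqVneq => [pi|pi].
    apply: cvg_near_cst; near=> e; rewrite pi add0r.
    have /eqP := pq i; rewrite pi expr0n/= add0r sqrf_eq1 => qi.
    have e0 : e != 0 by rewrite gt_eqF.
    by case/orP : qi => /eqP->; congr (_ * _); field.
  rewrite -[X in _ --> X](_ : w i * (0 / (p i + 0 * q i)) = 0); last first.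
    by rewrite mul0r mulr0.
  apply: cvg_at_right_filter; apply: (cvgM (cvg_cst (w i))).
  apply: (cvgM cvg_id); apply: cvgV; first by rewrite mul0r addr0.
  by apply: (cvgD (cvg_cst (p i))); exact: (cvgM cvg_id (cvg_cst (q i))).
have l0 : \sum_(i < m) l i != 0.
  rewrite (bigD1 i0)//= {1}/l pi0 eqxx qi0 mulr1.
  have [[j vj]|nj] := pselect (exists j, v j = - v i0).
    have ji0 : j != i0.
      apply/eqP => ji; move: vj ab; rewrite ji => vj.
      have ha : a = 0 by have /rowP/(_ 0) := vj; rewrite !mxE -/a; lra.
      have hb : b = 0 by have /rowP/(_ 1) := vj; rewrite !mxE -/b; lra.
      by rewrite ha hb expr0n/= addr0 => /eqP; rewrite eq_sym oner_eq0.
    have pj : p j = 0 by rewrite /p vj !mxE -/a -/b; ring.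
    have qj : q j = -1 by rewrite /q vj !mxE -/a -/b -ab; ring.
    rewrite (bigD1 j)//= {1}/l pj eqxx qj mulrN1 big1 ?addr0.
      by rewrite subr_eq0 eq_sym wopp.
    move=> i /andP[ii ij]; rewrite /l; case: eqP => // /p0E[/eqP|[vi _]].
      by rewrite (negbTE ii).
    by rewrite -vj in vi; rewrite (vI _ _ vi) eqxx in ij.
  rewrite big1 ?addr0// => i ii; rewrite /l; case: eqP => // /p0E[/eqP|[vi _]].
    by rewrite (negbTE ii).
  by case: nj; exists i.
have [e0 /= e0_gt0 good] : \forall e \near 0^'+,
    [/\ - b + e * a != 0, forall i, p i + e * q i != 0 &
      \sum_(i < m) w i * (e / (p i + e * q i)) != 0].
  have n1 : \forall e \near 0^'+, - b + e * a != 0.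
    by apply: near_affine_neq0; rewrite sqrrN addrC.
  have n2 : \forall e \near 0^'+, forall i, p i + e * q i != 0.
    by apply: filter_forall => i; exact: near_affine_neq0.
  have n3 := cvgr_neq0 _ lim l0.
  near=> e; split; near: e; [exact: n1|exact: n2|exact: n3].
pose e (n : nat) := e0 / (n.+2)%:R.
have e_gt0 n : 0 < e n by rewrite divr_gt0.
have eP n : [/\ - b + e n * a != 0, forall i, p i + e n * q i != 0 &
      \sum_(i < m) w i * (e n / (p i + e n * q i)) != 0].
  apply: good => //=; rewrite sub0r normrN gtr0_norm// ltr_pdivrMr//.
  by rewrite ltr_pMr// ltr1n.
(* the slope of the vector (- b + e * a, a + e * b) = v0^perp + e * v0 *)
exists (fun n => (a + e n * b) / (- b + e n * a)); split=> [n n'|n].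
  have [h1 _ _] := eP n; have [h1' _ _] := eP n'.
  move/eqP; rewrite eqr_div// -subr_eq0 => h.
  have : (e n' - e n) * (a ^+ 2 + b ^+ 2) = 0.
    by move/eqP : h => <-; ring.
  rewrite ab mulr1 => /eqP; rewrite subr_eq0 /e eq_sym => /eqP.
  move/(mulfI (lt0r_neq0 e0_gt0))/invr_inj/eqP; rewrite eqr_nat.
  by move=> /eqP[].
have [h1 h2 h3] := eP n; set k := _ / _.
have dE i : v i 0 0 + k * v i 0 1 = (p i + e n * q i) / (- b + e n * a).
  by rewrite /p /q /k; field.
split=> [i|]; first by rewrite dE mulf_neq0// invr_eq0.
apply: contra_neq h3 => h.
transitivity (e n / (- b + e n * a) * \sum_(i < m) w i / (v i 0 0 + k * v i 0 1)).
  by rewrite mulr_sumr; apply: eq_bigr => i _; rewrite dE; field; rewrite h1 h2.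
by rewrite h mulr0.
Unshelve. all: by end_near. Qed.

End Slopes.

(** * Integrals over parallel lines in the plane *)

Section Projections.
Context {R : realType}.
Implicit Types (F G : 'rV[R]_2 -> R) (p v w : 'rV[R]_2).
Local Notation mu := (@lebesgue_measure R).

Lemma coord_le_norm n (v : 'rV[R]_n) j : `|v 0 j| <= `|v|.
Proof.
rewrite [leRHS]/Num.Def.normr/= mx_normrE.
by apply: (@le_bigmax _ _ _ 0 (fun ij : 'I_1 * 'I_n => `|v ij.1 ij.2|) (0, j)).
Qed.

Lemma continuous_line {F} p v : continuous F ->
  continuous (fun t : R => F (p + t *: v)).
Proof.
move=> cF t; apply: (@continuous_comp R _ R (fun t => p + t *: v) F t); last exact: cF.
by apply: cvgD; [exact: cvg_cst|apply: cvgZl; exact: cvg_id].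
Qed.

Lemma Cc_bounded {F} : Cc F -> exists M, forall x, `|F x| <= M.
Proof.
move=> [T cF]; apply: (Ccball_bounded _ cF); apply: bounded_closed_compact.
  by exists T; split; [exact: num_real|move=> x Tx y /= /le_trans; apply; exact: ltW].
have -> : [set x : 'rV[R]_2 | `|x| <= T] = Num.norm @^-1` [set x | x <= T] by [].
apply: closed_comp; last exact: closed_le.
by move=> x _; exact: norm_continuous.
Qed.

Definition det2 v w : R := v 0 0 * w 0 1 - v 0 1 * w 0 0.

(** By Cramer's rule, a bound on the point [p + s *: v + t *: w] bounds both
    coordinates [s] and [t]. *)
Lemma box_plane {F} p v w : Cc F -> det2 v w != 0 ->
  exists T M, box T M (fun s t => F (p + s *: v + t *: w)).
Proof.
move=> cF d0; have [M FM] := Cc_bounded cF; have [T [cF' sF]] := cF.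
pose K := (T + `|p|) * (2 * (`|v| + `|w|)) / `|det2 v w|.
have sK s t : F (p + s *: v + t *: w) != 0 -> `|s| <= K /\ `|t| <= K.
  move=> Fn0; set z := p + _ + _ in Fn0.
  have zT : `|z - p| <= T + `|p|.
    apply: le_trans (ler_normB _ _) _; rewrite lerD2r leNgt.
    by apply: contra Fn0 => /sF->.
  have b (u : 'rV[R]_2) (j : 'I_2) : `|u 0 j| <= `|v| + `|w| ->
      forall i, `|(z - p) 0 i * u 0 j| <= (T + `|p|) * (`|v| + `|w|).
    move=> uj i; rewrite normrM; apply: ler_pM => //.
    exact: le_trans (coord_le_norm _ _ _) zT.
  have bv j : `|v 0 j| <= `|v| + `|w|.
    by apply: le_trans (coord_le_norm _ _ _) _; rewrite lerDl.
  have bw j : `|w 0 j| <= `|v| + `|w|.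
    by apply: le_trans (coord_le_norm _ _ _) _; rewrite lerDr.
  have es : s * det2 v w = (z - p) 0 0 * w 0 1 - (z - p) 0 1 * w 0 0.
    by rewrite /z !mxE /det2; ring.
  have et : t * det2 v w = (z - p) 0 1 * v 0 0 - (z - p) 0 0 * v 0 1.
    by rewrite /z !mxE /det2; ring.
  rewrite /K !ler_pdivlMr ?normr_gt0// -!normrM es et.
  split; apply: le_trans (ler_normB _ _) _.
    by have := b _ _ (bw 1) 0; have := b _ _ (bw 0) 1; lra.
  by have := b _ _ (bv 1) 0; have := b _ _ (bv 0) 1; lra.
exists K, M; split=> [s|t|//].
  split; first exact: continuous_line.
  by move=> t; rewrite ltNge; apply: contraNeq => /sK[].
split; last by move=> s; rewrite ltNge; apply: contraNeq => /sK[].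
under eq_fun do rewrite addrAC; exact: continuous_line.
Qed.

Definition e0 : 'rV[R]_2 := delta_mx 0 0.
Definition e1 : 'rV[R]_2 := delta_mx 0 1.

(** The lines [x + k * y = s] are parametrized by their second coordinate
    [y]. *)
Definition line_dir (k : R) : 'rV[R]_2 := e1 - k *: e0.

(** The Radon transform in the direction [(1, k)], up to the normalization of
    the direction. *)
Definition lineproj (k : R) F (s : R) : R := \int[mu]_y F (s *: e0 + y *: line_dir k).

Lemma e1_neq0 : e1 != 0.
Proof. by apply/eqP => /rowP/(_ 1); rewrite !mxE/=; lra. Qed.

Lemma line_dir_neq0 k : line_dir k != 0.
Proof. by apply/eqP => /rowP/(_ 1); rewrite !mxE/=; lra. Qed.

Lemma det2_e0_e1 : det2 e0 e1 = 1.
Proof. by rewrite /det2 !mxE/=; ring. Qed.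

Lemma det2_e0_line_dir k : det2 e0 (line_dir k) = 1.
Proof. by rewrite /det2 !mxE/=; ring. Qed.

Lemma Cc_line {F} p v : v != 0 -> Cc F -> Cc (fun t : R => F (p + t *: v)).
Proof.
move=> v0 [T [cF sF]]; exists ((T + `|p|) / `|v|); split; first exact: continuous_line.
move=> t; rewrite ltr_pdivrMr ?normr_gt0// -normrZ => h; apply: sF.
by have := ler_normB (p + t *: v) p; rewrite addrAC subrr add0r; lra.
Qed.

Lemma Cc_lineproj {F} k : Cc F -> Cc (lineproj k F).
Proof.
move=> cF; have d0 : det2 e0 (line_dir k) != 0 by rewrite det2_e0_line_dir oner_neq0.
have [T [M bF]] := box_plane 0 e0 (line_dir k) cF d0; exists T.
rewrite (_ : lineproj k F = (fun s => \int[mu]_y F (0 + s *: e0 + y *: line_dir k))).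
  exact: box_int_Ccball bF _.
by apply/funext => s; rewrite add0r.
Qed.

(** Along the lines [x + k * y = s] the beam has velocity [v 0 0 + k * v 0 1];
    its component inside the lines is absorbed by translation invariance. *)
Lemma lineproj_beam {F} k v s : Cc F -> v 0 0 + k * v 0 1 != 0 ->
  \int[mu]_y beam v F (s *: e0 + y *: line_dir k) =
  \int[mu]_(t in `[0, +oo[) lineproj k F (s + t * (v 0 0 + k * v 0 1)).
Proof.
move=> cF; set d := v 0 0 + _ => d0.
have det0 : det2 v (line_dir k) != 0.
  by rewrite /det2 !mxE/= (_ : _ - _ = d)//; rewrite /d; ring.
have [T [M bF]] := box_plane (s *: e0) v (line_dir k) cF det0.
transitivity (\int[mu]_y \int[mu]_(t in `[0, +oo[)
    F (s *: e0 + t *: v + y *: line_dir k)).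
  by apply: eq_Rintegral => y _; apply: eq_Rintegral => t _; rewrite addrAC.
rewrite (box_fubini_half bF); apply: eq_Rintegral => t _.
have [T' cT'] := Cc_line ((s + t * d) *: e0) _ (line_dir_neq0 k) cF.
rewrite /lineproj -(Rint_shift (t * v 0 1) cT'); apply: eq_Rintegral => y _.
by congr F; apply: rV2P; rewrite !mxE/= /d; ring.
Qed.

Lemma lineproj_sum {I : Type} (r : seq I) (c : I -> R) (F : I -> 'rV[R]_2 -> R) k s :
  (forall i, Cc (F i)) ->
  lineproj k (fun x => \sum_(i <- r) c i * F i x) s = \sum_(i <- r) c i * lineproj k (F i) s.
Proof.
move=> cF; rewrite /lineproj; apply: Rint_sum => // i.
exact: Cc_line (line_dir_neq0 k) (cF i).
Qed.

Lemma Cc_beam_line {F} k v s : Cc F -> v 0 0 + k * v 0 1 != 0 ->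
  Cc (fun y : R => beam v F (s *: e0 + y *: line_dir k)).
Proof.
move=> cF; set d := v 0 0 + _ => d0.
have det0 : det2 v (line_dir k) != 0.
  by rewrite /det2 !mxE/= (_ : _ - _ = d)//; rewrite /d; ring.
have [T [M bF]] := box_plane (s *: e0) v (line_dir k) cF det0.
exists T; rewrite (_ : (fun y => _) = (fun y => \int[mu]_(t in `[0, +oo[)
    F (s *: e0 + t *: v + y *: line_dir k))).
  exact: box_int_Ccball (box_swap bF) _.
by apply/funext => y; apply: eq_Rintegral => t _; rewrite addrAC.
Qed.

Lemma primitive_sum {I : Type} (r : seq I) (c : I -> R) (F : I -> R -> R) s :
  (forall i, Cc (F i)) ->
  primitive (fun x => \sum_(i <- r) c i * F i x) s = \sum_(i <- r) c i * primitive (F i) s.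
Proof. by move=> cF; rewrite /primitive; exact: Rint_sum. Qed.

Lemma primitive_far {I : finType} (F : I -> R -> R) : (forall i, Cc (F i)) ->
  exists s, forall i, primitive (F i) s = 0.
Proof.
move=> cF; have /choice[T FT] : forall i, exists T, Ccball T (F i) by exact: cF.
exists (- \sum_i `|T i| - 1) => i; apply: (primitive_left _ (FT i).2).
have : T i <= \sum_i `|T i|.
  apply: le_trans (ler_norm _) _; rewrite (bigD1 i)//= lerDl.
  exact: sumr_ge0.
lra.
Qed.

(** The half-line integrals of the projections are constants minus primitives,
    and the constants add up to 0 because the identity also holds to the left of
    all supports. So the primitive of the sum in the conclusion vanishes
    identically. *)
Lemma star_lineproj_eq0 {m} (v : 'I_m -> 'rV[R]_2) (c : 'I_m -> R)
    (F : 'I_m -> 'rV[R]_2 -> R) k : (forall i, Cc (F i)) ->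
  (forall x, \sum_(i < m) c i * beam (v i) (F i) x = 0) ->
  (forall i, v i 0 0 + k * v i 0 1 != 0) ->
  forall s, \sum_(i < m) c i / (v i 0 0 + k * v i 0 1) * lineproj k (F i) s = 0.
Proof.
move=> cF star0; set d := fun i => v i 0 0 + k * v i 0 1 => d0.
have cP i : Cc (lineproj k (F i)) by exact: Cc_lineproj.
pose K := \sum_(i < m) c i / d i * (if 0 < d i then \int[mu]_t lineproj k (F i) t else 0).
have KE s : \sum_(i < m) c i / d i * primitive (lineproj k (F i)) s = K.
  have : \int[mu]_y (\sum_(i < m) c i * beam (v i) (F i) (s *: e0 + y *: line_dir k)) = 0.
    by under eq_Rintegral do rewrite star0; rewrite Rintegral_cst// mul0r.
  rewrite (@Rint_sum _ _ setT _ _ (fun i y => beam (v i) (F i) (s *: e0 + y *: line_dir k)))//;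
    last by move=> i; exact: Cc_beam_line.
  move=> h; apply/eqP; rewrite eq_sym -subr_eq0 -sumrB -[X in _ == X]h; apply/eqP.
  apply: eq_bigr => i _; rewrite lineproj_beam//; have [T cT] := cP i.
  by rewrite (Rint_half_line _ _ cT (d0 i)) -mulrBr mulrAC mulrA.
have K0 : K = 0.
  have [s ps] := primitive_far _ cP.
  by rewrite -(KE s); apply: big1 => i _; rewrite ps mulr0.
have [T cS] := Cc_sum (index_enum 'I_m) (fun i => c i / d i) _ cP.
have z := primitive_eq0 cS; move=> s.
have : (fun x => \sum_(i < m) c i / d i * lineproj k (F i) x) = cst 0.
  by apply: z => x; rewrite primitive_sum// KE.
by move/(congr1 (fun f => f s)).
Qed.

(** The change of variables [(x, y) -> (x + k * y, y)] is a translation in [x]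
    for each [y]. *)
Lemma plane_shear {G} k : Cc G ->
  \int[mu]_s lineproj k G s = \int[mu]_x \int[mu]_y G (x *: e0 + y *: e1).
Proof.
move=> cG; have d0 : det2 e0 (line_dir k) != 0 by rewrite det2_e0_line_dir oner_neq0.
have [T [M bG]] := box_plane 0 e0 (line_dir k) cG d0.
have d1 : det2 e0 e1 != 0 by rewrite det2_e0_e1 oner_neq0.
have [T' [M' bG']] := box_plane 0 e0 e1 cG d1.
transitivity (\int[mu]_s \int[mu]_y G (0 + s *: e0 + y *: line_dir k)).
  by apply: eq_Rintegral => s _; apply: eq_Rintegral => y _; rewrite add0r.
rewrite -(box_fubini bG).
transitivity (\int[mu]_x \int[mu]_y G (0 + x *: e0 + y *: e1)); last first.
  by apply: eq_Rintegral => s _; apply: eq_Rintegral => y _; rewrite add0r.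
rewrite -(box_fubini bG'); apply: eq_Rintegral => y _.
have [_ cy _] := bG.
(* s = x + k * y *)
rewrite -(Rint_shift (k * y) (cy y)); apply: eq_Rintegral => x _.
by congr G; apply: rV2P; rewrite !mxE/=; ring.
Qed.

Definition moment G i j :=
  \int[mu]_x (x ^+ i * \int[mu]_y (y ^+ j * G (x *: e0 + y *: e1))).

Lemma Cc_slice {G} j x : Cc G -> Cc (fun y : R => y ^+ j * G (x *: e0 + y *: e1)).
Proof.
move=> cG; apply: CcM; first exact: exprn_continuous.
exact: Cc_line e1_neq0 cG.
Qed.

Lemma Cc_slice_int {G} j : Cc G ->
  Cc (fun x : R => \int[mu]_y (y ^+ j * G (x *: e0 + y *: e1))).
Proof.
move=> cG; have cH : Cc (fun v : 'rV[R]_2 => v 0 1 ^+ j * G v).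
  apply: CcM cG => v.
  apply: (@continuous_comp _ R R (fun v : 'rV[R]_2 => v 0 1) (fun t => t ^+ j)).
    exact: coord_continuous.
  exact: exprn_continuous.
have d1 : det2 e0 e1 != 0 by rewrite det2_e0_e1 oner_neq0.
have [T [M bH]] := box_plane 0 e0 e1 cH d1; exists T.
rewrite (_ : (fun x => _) = (fun x => \int[mu]_y
    (fun v : 'rV[R]_2 => v 0 1 ^+ j * G v) (0 + x *: e0 + y *: e1))).
  exact: box_int_Ccball bH _.
apply/funext => x; apply: eq_Rintegral => y _; rewrite add0r; congr (_ ^+ _ * _).
by rewrite !mxE/=; ring.
Qed.

(** The integral over the plane of [(x + k * y) ^ n * G], computed along the
    lines where the first factor is constant and, after expansion of the power,
    in Cartesian coordinates. *)
Lemma lineproj_moments {G} k n : Cc G -> (forall s, lineproj k G s = 0) ->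
  \sum_(j < n.+1) ('C(n, j)%:R * moment G (n - j) j) * k ^+ j = 0.
Proof.
move=> cG pG; pose H (v : 'rV[R]_2) := (v 0 0 + k * v 0 1) ^+ n * G v.
have cH : Cc H.
  apply: CcM cG => v.
  apply: (@continuous_comp _ R R (fun v : 'rV[R]_2 => v 0 0 + k * v 0 1) (fun t => t ^+ n)).
    have h0 := @coord_continuous R 1 2 0 0 v.
    have h1 := @coord_continuous R 1 2 0 1 v.
    exact: (cvgD h0 (cvgM (cvg_cst k) h1)).
  exact: exprn_continuous.
have hz : \int[mu]_s lineproj k H s = 0.
  have z s : lineproj k H s = 0.
    transitivity (\int[mu]_y (s ^+ n * G (s *: e0 + y *: line_dir k))).
      apply: eq_Rintegral => y _; congr (_ ^+ _ * _); rewrite !mxE/=; ring.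
    rewrite RintegralZl//; first by rewrite -/(lineproj k G s) pG mulr0.
    by apply: Cc_integrable => //; exact: Cc_line (line_dir_neq0 k) cG.
  by under eq_Rintegral do rewrite z; rewrite Rintegral_cst// mul0r.
rewrite -[RHS]hz (plane_shear k cH).
pose a (j : 'I_n.+1) := 'C(n, j)%:R * k ^+ j.
transitivity (\sum_(j < n.+1) a j * moment G (n - j) j).
  by apply: eq_bigr => j _; rewrite /a mulrAC.
rewrite /moment -(@Rint_sum _ _ setT _ _ (fun (j : 'I_n.+1) x => x ^+ (n - j) *
   \int[mu]_y (y ^+ j * G (x *: e0 + y *: e1))))//; last first.
  by move=> j; apply: CcM; [exact: exprn_continuous|exact: Cc_slice_int].
apply: eq_Rintegral => x _.
transitivity (\sum_(j < n.+1) (a j * x ^+ (n - j)) *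
    \int[mu]_y (y ^+ j * G (x *: e0 + y *: e1))).
  by apply: eq_bigr => j _; rewrite mulrA.
rewrite -(@Rint_sum _ _ setT _ _ (fun (j : 'I_n.+1) y => (y ^+ j * G (x *: e0 + y *: e1))))//;
  last by move=> j; exact: Cc_slice.
apply: eq_Rintegral => y _; rewrite /H.
have -> : (x *: e0 + y *: e1) 0 0 = x by rewrite !mxE/=; ring.
have -> : (x *: e0 + y *: e1) 0 1 = y by rewrite !mxE/=; ring.
rewrite exprDn mulr_suml; apply: eq_bigr => j _.
by rewrite /a exprMn -mulr_natl; ring.
Qed.

(** The identity of the preceding lemma, for more than [n] values of [k], makes
    the moments of order [n] vanish; then [moments_eq0] applies in the first
    variable and in the second. *)
Lemma radon_inj {G} (k : nat -> R) : Cc G -> injective k ->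
  (forall n s, lineproj (k n) G s = 0) -> forall x, G x = 0.
Proof.
move=> cG kI pG.
have m0 i j : moment G i j = 0.
  pose n := (i + j)%N.
  pose p := \poly_(l < n.+1) ('C(n, l)%:R * moment G (n - l) l).
  have p0 : p = 0.
    apply/eqP; apply: contraT => pn0.
    have rs : all (root p) (map k (iota 0 n.+1)).
      apply/allP => _ /mapP[l _ ->]; apply/rootP.
      by rewrite horner_poly; exact: lineproj_moments.
    have := max_poly_roots pn0 rs; rewrite map_inj_uniq ?iota_uniq// => /(_ isT).
    by rewrite size_map size_iota ltnNge size_poly.
  have := congr1 (fun q : {poly R} => q`_j) p0; rewrite coef0 coef_poly.
  rewrite ltnS leq_addl => /eqP; rewrite mulf_eq0 addnK pnatr_eq0.
  by rewrite eqn0Ngt bin_gt0 leq_addl/= => /eqP.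
have s0 j x : \int[mu]_y (y ^+ j * G (x *: e0 + y *: e1)) = 0.
  exact: (moments_eq0 (Cc_slice_int j cG) (m0^~ j)).
move=> v; have -> : v = v 0 0 *: e0 + v 0 1 *: e1.
  by apply: rV2P; rewrite !mxE/=; ring.
apply: (@moments_eq0 _ (fun y => G (v 0 0 *: e0 + y *: e1))) => //.
exact: Cc_line e1_neq0 cG.
Qed.

End Projections.

(** * Smooth functions with vanishing line integrals *)

Section NullFunctions.
Context {R : realType}.
Implicit Types (g : R -> R) (h : 'rV[R]_2 -> R) (u v : 'rV[R]_2) (T : R).
Local Notation mu := (@lebesgue_measure R).

(** Iterating the translation leaves the support. *)
Lemma periodic_eq0 {V : normedModType R} {T} {h : V -> R} {v : V} :
  supp_in T h -> v != 0 -> (forall x, h (x + v) = h x) -> forall x, h x = 0.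
Proof.
move=> sh v0 hv x; have hn n : h (x + n%:R *: v) = h x.
  elim: n => [|n IH]; first by rewrite scale0r addr0.
  by rewrite -natr1 scalerDl scale1r addrA hv.
have K0 : 0 <= (`|T| + `|x|) / `|v| by rewrite divr_ge0// addr_ge0.
have := archi_boundP K0; set n := Num.bound _.
rewrite ltr_pdivrMr ?normr_gt0// => nP; rewrite -(hn n); apply: sh.
have := ler_normB (x + n%:R *: v) x; rewrite addrAC subrr add0r normrZ normr_nat.
have := ler_norm T; lra.
Qed.

(** The one-dimensional counterpart of [Ck]; the derivatives are given as
    functions, so that they can be multiplied by functions of the other
    coordinate. *)
Fixpoint smooth (n : nat) g : Prop := continuous g /\
  if n is n'.+1 then
    exists g', (forall t : R, is_derive t 1 g (g' t)) /\ smooth n' g'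
  else True.

Lemma smooth_cont {n g} : smooth n g -> continuous g.
Proof. by case: n => [|n] []. Qed.

Lemma smoothS {n g} : smooth n.+1 g -> smooth n g.
Proof.
elim: n g => [|n IH] g [cg [g' [dg sg]]]; split=> //.
by exists g'; split=> //; exact: IH.
Qed.

Lemma is_derive_shift1 {g} {a t d : R} : is_derive (t + a) 1 g d ->
  is_derive t 1 (fun t => g (t + a)) d.
Proof.
move=> dg; have da : is_derive t 1 (fun t : R => t + a) 1.
  by apply: is_derive_eq (is_deriveD (is_derive_id t (1:R)) (is_derive_cst a t (1:R))) _;
     rewrite addr0.
have := @is_derive1_comp R g _ t _ _ dg da; rewrite mulr1; exact.
Qed.

Lemma smooth_shift {n g} a : smooth n g -> smooth n (fun t => g (t + a)).
Proof.
elim: n g => [|n IH] g [cg H]; (split; first (move=> t;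
  apply: (@continuous_comp R R R (fun t => t + a) g t);
  [by apply: cvgD; [exact: cvg_id|exact: cvg_cst]|exact: cg])) => //.
case: H => g' [dg sg]; exists (fun t => g' (t + a)); split=> [t|]; last exact: IH.
exact: is_derive_shift1.
Qed.

Lemma smoothB {n f g} : smooth n f -> smooth n g -> smooth n (fun t => f t - g t).
Proof.
elim: n f g => [|n IH] f g [cf Hf] [cg Hg];
  (split; first by move=> t; apply: cvgB; [exact: cf|exact: cg]) => //.
case: Hf => f' [df sf]; case: Hg => g' [dg sg].
exists (fun t => f' t - g' t); split=> [t|]; last exact: IH.
exact: is_deriveB.
Qed.

(** Each step gains a derivative by averaging over an interval, which is a
    difference of primitives; starting from a tent function, this constructs
    B-splines. The average is not zero, since otherwise the function would be
    periodic. *)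
Lemma exists_smooth n T : 0 < T ->
  exists g, [/\ smooth n g, supp_in T g & exists x, g x != 0].
Proof.
elim: n T => [|n IH] T T0.
  (* twice the tent function of height T *)
  exists (fun t => (T - `|t|) + `|T - `|t| |); split.
  - split=> // t; have c1 : (fun t : R => T - `|t|) @ t --> T - `|t|.
      exact: (cvgB (cvg_cst T) (@norm_continuous _ _ t)).
    exact: cvgD c1 (cvg_norm c1).
  - by move=> t tT; rewrite (@ltr0_norm _ (T - `|t|)) ?subrr// subr_lt0.
  - by exists 0; rewrite normr0 subr0 gtr0_norm// gt_eqF// addr_gt0.
have T20 : 0 < T / 2 by rewrite divr_gt0.
have [g [sg suppg [x gx]]] := IH _ T20.
have cg : Ccball (T / 2) g by split=> //; exact: smooth_cont sg.
pose G t := primitive g (t + T / 2) - primitive g t.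
have dG (t : R) : is_derive t 1 G (g (t + T / 2) - g t).
  apply: is_deriveB; last exact: primitive_derive cg t.
  exact: is_derive_shift1 (primitive_derive cg _).
exists G; split.
- split.
    move=> t; apply: differentiable_continuous; apply/derivable1_diffP.
    by have [] := dG t.
  by exists (fun t => g (t + T / 2) - g t); split=> //; exact/smoothB/sg/smooth_shift.
- move=> t; rewrite /G lter_normr => /orP[tT|tT].
    by rewrite !(primitive_right _ suppg) ?subrr//; lra.
  by rewrite !(primitive_left _ suppg) ?subrr//; lra.
- apply: contrapT => G0; move/eqP: gx; apply.
  apply: (periodic_eq0 suppg (lt0r_neq0 T20)) => t; apply/eqP; rewrite -subr_eq0.
  have := dG t; have -> : G = cst 0.
    by apply/funext => s; apply/eqP; apply: contrapT => /negP Gs; case: G0; exists s.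
  by move=> d0; rewrite -(@derive_val _ _ _ _ _ _ _ d0) derive_cst.
Qed.

Definition tensor (f g : R -> R) (x : 'rV[R]_2) := f (x 0 0) * g (x 0 1).

Lemma cvg_quotient {V : normedModType R} {f : V -> R} {x v : V} {d : R} :
  is_derive x v f d ->
  (fun t : R => t^-1 *: ((f \o shift x) (t *: v) - f x)) @ 0^' --> d.
Proof. by move=> [df <-]. Qed.

Lemma is_derive_cvg {V : normedModType R} {f : V -> R} {x v : V} {d : R} :
  (fun t : R => t^-1 *: ((f \o shift x) (t *: v) - f x)) @ 0^' --> d ->
  is_derive x v f d.
Proof.
by move=> h; apply: DeriveDef; [exact: (cvgP _ h)|exact: (cvg_lim (@Rhausdorff R) h)].
Qed.

Lemma tensor_derive0 {f g : R -> R} {d} {x : 'rV[R]_2} : is_derive (x 0 0) 1 f d ->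
  is_derive x (delta_mx 0 0) (tensor f g) (d * g (x 0 1)).
Proof.
move=> /cvg_quotient df; apply: is_derive_cvg.
rewrite [X in X @ _](_ : _ = (fun t : R =>
  (t^-1 *: ((f \o shift (x 0 0)) (t *: 1) - f (x 0 0))) * g (x 0 1))).
  exact: (cvgM df (cvg_cst (g (x 0 1)))).
apply/funext => t /=; rewrite /tensor !mxE/= !mulr1 mulr0 add0r /GRing.scale/= !mulr1; ring.
Qed.

Lemma tensor_derive1 {f g : R -> R} {d} {x : 'rV[R]_2} : is_derive (x 0 1) 1 g d ->
  is_derive x (delta_mx 0 1) (tensor f g) (f (x 0 0) * d).
Proof.
move=> /cvg_quotient df; apply: is_derive_cvg.
rewrite [X in X @ _](_ : _ = (fun t : R => f (x 0 0) *
  (t^-1 *: ((g \o shift (x 0 1)) (t *: 1) - g (x 0 1))))).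
  exact: (cvgM (cvg_cst (f (x 0 0))) df).
apply/funext => t /=; rewrite /tensor !mxE/= !mulr1 mulr0 add0r /GRing.scale/= !mulr1; ring.
Qed.

Lemma tensor_continuous {f g : R -> R} : continuous f -> continuous g ->
  continuous (tensor f g).
Proof.
move=> cf cg x.
have c0 : {for x, continuous (fun v : 'rV[R]_2 => f (v 0 0))}.
  apply: (@continuous_comp _ R R (fun v : 'rV[R]_2 => v 0 0) f); last exact: cf.
  exact: coord_continuous.
have c1 : {for x, continuous (fun v : 'rV[R]_2 => g (v 0 1))}.
  apply: (@continuous_comp _ R R (fun v : 'rV[R]_2 => v 0 1) g); last exact: cg.
  exact: coord_continuous.
exact: cvgM c0 c1.
Qed.

Lemma Ck_tensor n {f g : R -> R} : smooth n f -> smooth n g -> Ck n (tensor f g).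
Proof.
elim: n f g => [|n IH] f g sf sg;
  (split; first exact: tensor_continuous (smooth_cont sf) (smooth_cont sg)) => //.
have [_ [f' [df sf']]] := sf; have [_ [g' [dg sg']]] := sg.
move=> [[|[|//]] ilt].
  rewrite (_ : Ordinal ilt = 0); last exact: val_inj.
  have D x := @tensor_derive0 f g _ x (df (x 0 0)).
  split=> [x|]; first by have [] := D x.
  rewrite (_ : (fun x => _) = tensor f' g); first exact: IH sf' (smoothS sg).
  by apply/funext => x; exact: (@derive_val _ _ _ _ _ _ _ (D x)).
rewrite (_ : Ordinal ilt = 1); last exact: val_inj.
have D x := @tensor_derive1 f g _ x (dg (x 0 1)).
split=> [x|]; first by have [] := D x.
rewrite (_ : (fun x => _) = tensor f g'); first exact: IH (smoothS sf) sg'.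
by apply/funext => x; exact: (@derive_val _ _ _ _ _ _ _ (D x)).
Qed.

Lemma Ck_cont {n h} : Ck n h -> continuous h.
Proof. by case: n => [|n] []. Qed.

Lemma CkB {n} {h k : 'rV[R]_2 -> R} : Ck n h -> Ck n k -> Ck n (fun x => h x - k x).
Proof.
elim: n h k => [|n IH] h k ch ck;
  (split; first by move=> x; exact: (cvgB (Ck_cont ch x) (Ck_cont ck x))) => //.
move=> i; have [dh {}ch] := ch.2 i; have [dk {}ck] := ck.2 i.
split=> [x|]; first exact: derivableB.
rewrite (_ : (fun x => _) = (fun x => 'D_(delta_mx 0 i) h x - 'D_(delta_mx 0 i) k x)).
  exact: IH.
by apply/funext => x; exact: deriveB.
Qed.

Lemma CkZ {n h} (a : R) : Ck n h -> Ck n (fun x => a * h x).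
Proof.
elim: n h => [|n IH] h ch;
  (split; first by move=> x; exact: (cvgM (cvg_cst a) (Ck_cont ch x))) => //.
move=> i; have [dh {}ch] := ch.2 i; split=> [x|]; first exact: derivableZ.
rewrite (_ : (fun x => _) = (fun x => a * 'D_(delta_mx 0 i) h x)).
  exact: IH.
by apply/funext => x; exact: deriveZ.
Qed.

Lemma Ck_shift {n h} v : Ck n h -> Ck n (fun x => h (x + v)).
Proof.
elim: n h => [|n IH] h ch; (split; first (move=> x;
    exact: (continuous_comp (cvgD cvg_id (cvg_cst v)) (Ck_cont ch (x + v))))) => //.
move=> i; have [dh {}ch] := ch.2 i.
have D x : is_derive x (delta_mx 0 i) (fun x => h (x + v)) ('D_(delta_mx 0 i) h (x + v)).
  apply: is_derive_cvg; have := cvg_quotient (derivableP (dh (x + v))).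
  rewrite [X in X @ _](_ : _ = (fun t : R =>
    t^-1 *: (((fun x => h (x + v)) \o shift x) (t *: delta_mx 0 i) - h (x + v))))//.
  by apply/funext => t /=; rewrite addrA.
split=> [x|]; first by have [] := D x.
rewrite (_ : (fun x => _) = (fun x => 'D_(delta_mx 0 i) h (x + v))); first exact: (IH _ ch).
by apply/funext => x; exact: (@derive_val _ _ _ _ _ _ _ (D x)).
Qed.

Lemma norm_rV2_le (x : 'rV[R]_2) T : `|x 0 0| <= T -> `|x 0 1| <= T -> `|x| <= T.
Proof.
move=> x0 x1; rewrite [leLHS]/Num.Def.normr/= mx_normrE.
apply/bigmax_leP; split=> [|[i j] _ /=]; first exact: le_trans x0.
rewrite (ord1 i); case: j => [[|[|//]] jlt].
  by rewrite (_ : Ordinal jlt = 0)//; exact: val_inj.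
by rewrite (_ : Ordinal jlt = 1)//; exact: val_inj.
Qed.

(** By induction on the list of directions, [h] is replaced by its difference
    in the new direction: translation invariance makes the integrals along that
    direction vanish, and the integrals along the previous directions are still
    zero. *)
Lemma exists_null_lines (vs : seq 'rV[R]_2) T : 0 < T -> (forall v, v \in vs -> v != 0) ->
  exists h, [/\ Ck 2 h, supp_in T h, exists x, h x != 0 &
    forall v, v \in vs -> forall x, \int[mu]_t h (x + t *: v) = 0].
Proof.
elim: vs T => [|v vs IH] T T0 vs0.
  have [g [sg suppg [a ga]]] := exists_smooth 2 T T0.
  exists (tensor g g); split=> //; first exact: Ck_tensor.
    move=> x xT; rewrite /tensor; have [x0|/suppg->] := leP `|x 0 0| T; last by rewrite mul0r.
    have [x1|/suppg->] := leP `|x 0 1| T; last by rewrite mulr0.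
    by move: xT; rewrite ltNge norm_rV2_le.
  by exists (const_mx a); rewrite /tensor !mxE mulf_neq0.
have v0 : v != 0 by apply: vs0; rewrite mem_head.
have T20 : 0 < T / 2 by rewrite divr_gt0.
have [|h [ch sh [a ha] hvs]] := IH _ T20.
  by move=> u uvs; apply: vs0; rewrite inE uvs orbT.
pose e := T / 2 / `|v|; have e0 : e != 0 by rewrite mulf_neq0 ?invr_eq0 ?normr_eq0// gt_eqF.
have nev : `|e *: v| = T / 2.
  by rewrite normrZ gtr0_norm ?divr_gt0 ?normr_gt0// divfK// normr_eq0.
exists (fun x => h (x + e *: v) - h x); split.
- exact/CkB/ch/Ck_shift.
- move=> x xT; rewrite (sh x); last lra.
  rewrite sh ?subrr//.
  by have := ler_normB (x + e *: v) (e *: v); rewrite addrK nev; lra.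
- apply: contrapT => h0; move/eqP: ha; apply.
  apply: (periodic_eq0 sh (_ : e *: v != 0)); first by rewrite scaler_eq0 negb_or e0.
  by move=> x; apply/eqP; rewrite -subr_eq0; apply: contrapT => /negP hx; case: h0; exists x.
- have Ch : Cc h by exists (T / 2); split=> //; exact: (Ck_cont ch).
  move=> u uvs x; have u0 : u != 0 by exact: vs0.
  have e1 t : h (x + t *: u + e *: v) = h (x + e *: v + t *: u) by rewrite addrAC.
  under eq_Rintegral do rewrite e1.
  rewrite RintegralB//; try exact: (Cc_integrable _ _ (Cc_line _ _ u0 Ch)).
  move: uvs; rewrite inE => /orP[/eqP uv|uvs]; last by rewrite !hvs// subrr.
  have [T' cT'] := Cc_line x _ u0 Ch.
  rewrite -(Rint_shift e cT'); apply/eqP; rewrite subr_eq0; apply/eqP.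
  by apply: eq_Rintegral => t _; rewrite uv scalerDl addrA addrAC.
Qed.

Lemma beam_opp {h} v x : Cc h -> v != 0 ->
  beam v h x + beam (- v) h x = \int[mu]_t h (x + t *: v).
Proof.
move=> ch v0; have [T cT] := Cc_line x _ v0 ch.
have -> : beam v h x = \int[mu]_(t in `[0, +oo[) h (x + (0 + t * 1) *: v).
  by apply: eq_Rintegral => t _; rewrite add0r mulr1.
have -> : beam (- v) h x = \int[mu]_(t in `[0, +oo[) h (x + (0 + t * (-1)) *: v).
  by apply: eq_Rintegral => t _; rewrite add0r mulrN1 scaleNr scalerN.
rewrite (Rint_half_line 0 1 cT) ?oner_neq0// (Rint_half_line 0 (-1) cT) ?oppr_eq0 ?oner_neq0//.
by rewrite ltr01 ltr0N1; field.
Qed.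

End NullFunctions.

(** * The rows of the star transform *)

Section StarTransform.
Context {R : realType}.
Implicit Types (h : 'rV[R]_2 -> R) (u v : 'rV[R]_2).
Local Notation mu := (@lebesgue_measure R).

(** The tensors that [star] pairs with the field, in one row-indexed family. *)
Definition frame_tensor (v : 'rV[R]_2) (j : 'I_3) : 'rV[R]_3 :=
  [:: tsq v; todot v (perp v); tsq (perp v)]`_j.

Lemma star_entry {m} (gamma : 'I_m -> 'rV[R]_2) (c : 'I_m -> R) f x j :
  star gamma c f x 0 j =
  \sum_(i < m) c i * beam (gamma i) (fun y => dotv (f y) (frame_tensor (gamma i) j)) x.
Proof.
rewrite /star summxE; apply: eq_bigr => i _; rewrite !mxE; congr (_ * beam _ _ _).
by apply/funext => y; rewrite mxE /frame_tensor; case: j => [[|[|[|]]]].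
Qed.

Lemma beam_sum {I : Type} (r : seq I) (a : I -> R) (F : I -> 'rV[R]_2 -> R) v x :
  v != 0 -> (forall i, Cc (F i)) ->
  beam v (fun y => \sum_(i <- r) a i * F i y) x = \sum_(i <- r) a i * beam v (F i) x.
Proof.
move=> v0 cF; rewrite /beam.
rewrite (@Rint_sum _ _ `[0, +oo[%classic _ _ (fun i t => F i (x + t *: v)))//.
by move=> i; exact: Cc_line.
Qed.

Lemma beam_dot (f : 'rV[R]_2 -> 'rV[R]_3) v (N : 'rV[R]_3) x : v != 0 ->
  (forall l, Cc (fun y => f y 0 l)) ->
  beam v (fun y => dotv (f y) N) x = \sum_(l < 3) N 0 l * beam v (fun y => f y 0 l) x.
Proof.
move=> v0 cf; rewrite -beam_sum//; congr (beam _ _ _); apply/funext => y.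
by apply: eq_bigr => l _; rewrite mulrC.
Qed.

Lemma C2c_Cc {D} {f : 'rV[R]_2 -> 'rV[R]_3} : C2c_S2 D f -> forall l, Cc (fun x => f x 0 l).
Proof.
move=> Df l; have [cf [cK _]] := Df l.
have [M [_ MP]] := compact_bounded cK.
exists (M + 1); split; first exact: Ck_cont cf.
move=> x xM; apply/eqP; apply: contraT => fx.
have : `|x| <= M + 1 by apply: (MP (M + 1)); [rewrite ltrDl|exact: subset_closure].
by rewrite leNgt xM.
Qed.

Lemma enorm1_neq0 v : enorm v = 1 -> v != 0.
Proof.
move/enorm1 => h; apply/eqP => v0; move: h; rewrite v0 !mxE expr0n/= addr0.
by move/eqP; rewrite eq_sym oner_eq0.
Qed.

Lemma sum3 (F : 'I_3 -> R) : \sum_(l < 3) F l = F 0 + F 1 + F 2.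
Proof.
rewrite !big_ord_recl big_ord0 addr0 addrA.
by congr (_ + F _ + F _); exact: val_inj.
Qed.

(** The projected equations for the difference of two fields with equal data.
    For a unit vector the first and last frame tensors add up to [(1, 0, 1)],
    which gives the trace equation; their difference and twice the middle one
    give a system for the trace-free part whose matrix [[al, be], [-be, al]] is a
    combination of rotations. *)
Lemma star_eq_lineproj {m} {gamma : 'I_m -> 'rV[R]_2} {c : 'I_m -> R} {D f1 f2} {k : R} :
  (forall i, enorm (gamma i) = 1) -> C2c_S2 D f1 -> C2c_S2 D f2 ->
  star gamma c f1 = star gamma c f2 ->
  (forall i, gamma i 0 0 + k * gamma i 0 1 != 0) ->
  let P (l : 'I_3) (s : R) := lineproj k (fun x : 'rV[R]_2 => f1 x 0 l - f2 x 0 l) s in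
  let w i := c i / (gamma i 0 0 + k * gamma i 0 1) in
  let al := \sum_(i < m) w i * (gamma i 0 0 ^+ 2 - gamma i 0 1 ^+ 2) in
  let be := \sum_(i < m) w i * (2 * gamma i 0 0 * gamma i 0 1) in
  forall s, [/\ (\sum_(i < m) w i) * (P 0 s + P 2 s) = 0,
    al * (P 0 s - P 2 s) + be * P 1 s = 0 &
    al * P 1 s - be * (P 0 s - P 2 s) = 0].
Proof.
move=> g1 D1 D2 eqf d0 P w al be s.
have g0 i : gamma i != 0 by exact: enorm1_neq0.
have C1 := C2c_Cc D1; have C2 := C2c_Cc D2.
pose g (l : 'I_3) (x : 'rV[R]_2) := f1 x 0 l - f2 x 0 l.
have Cg (l : 'I_3) : Cc (g l) by exact: CcB.
have beamB l v x : v != 0 ->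
    beam v (g l) x = beam v (fun y => f1 y 0 l) x - beam v (fun y => f2 y 0 l) x.
  move=> v0; rewrite /beam /g RintegralB//.
    exact: (Cc_integrable _ _ (Cc_line _ _ v0 (C1 l))).
  exact: (Cc_integrable _ _ (Cc_line _ _ v0 (C2 l))).
pose F j i x := \sum_(l < 3) frame_tensor (gamma i) j 0 l * g l x.
have CF j i : Cc (F j i) by exact: Cc_sum.
have F0 j x : \sum_(i < m) c i * beam (gamma i) (F j i) x = 0.
  have : star gamma c f1 x 0 j - star gamma c f2 x 0 j = 0 by rewrite eqf subrr.
  rewrite !star_entry -sumrB => h; rewrite -[RHS]h; apply: eq_bigr => i _.
  rewrite beam_sum// !beam_dot// -mulrBr -sumrB; congr (_ * _).
  by apply: eq_bigr => l _; rewrite beamB// mulrBr.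
have Q j : \sum_(i < m) w i * \sum_(l < 3) frame_tensor (gamma i) j 0 l * P l s = 0.
  rewrite -[RHS](star_lineproj_eq0 gamma c (F j) k (CF j) (F0 j) d0 s).
  by apply: eq_bigr => i _; rewrite lineproj_sum.
have q0 : \sum_(i < m) w i * (gamma i 0 0 ^+ 2 * P 0 s +
    gamma i 0 0 * gamma i 0 1 * P 1 s + gamma i 0 1 ^+ 2 * P 2 s) = 0.
  by rewrite -[RHS](Q 0); apply: eq_bigr => i _; rewrite sum3 /frame_tensor/= !mxE.
have q1 : \sum_(i < m) w i * (- (gamma i 0 0 * gamma i 0 1) * P 0 s
    + (gamma i 0 0 ^+ 2 - gamma i 0 1 ^+ 2) / 2 * P 1 s
    + gamma i 0 0 * gamma i 0 1 * P 2 s) = 0.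
  by rewrite -[RHS](Q 1); apply: eq_bigr => j _; congr (_ * _);
  rewrite sum3 /frame_tensor/= !mxE/=; move: (P _ _) (P _ _) (P _ _) => p0 p1 p2; field.
have q2 : \sum_(i < m) w i * (gamma i 0 1 ^+ 2 * P 0 s -
    gamma i 0 0 * gamma i 0 1 * P 1 s + gamma i 0 0 ^+ 2 * P 2 s) = 0.
  by rewrite -[RHS](Q 2); apply: eq_bigr => j _; congr (_ * _);
  rewrite sum3 /frame_tensor/= !mxE/=; move: (P _ _) (P _ _) (P _ _) => p0 p1 p2; ring.
have h i := enorm1 _ (g1 i).
clear -q0 q1 q2 h; move: (P 0 s) (P 1 s) (P 2 s) q0 q1 q2 => p0 p1 p2 q0 q1 q2.
split.
- transitivity (0 + 0 : R); last by rewrite addr0.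
  rewrite -[X in _ = X + _]q0 -[X in _ = _ + X]q2 mulr_suml -big_split/=.
  by apply: eq_bigr => i _; rewrite -[LHS]mulr1 -(h i); ring.
- transitivity (0 - 0 : R); last by rewrite subr0.
  rewrite -[X in _ = X - _]q0 -[X in _ = _ - X]q2 /al /be !mulr_suml -big_split -sumrB/=.
  by apply: eq_bigr => i _; ring.
- transitivity (2 * 0 : R); last by rewrite mulr0.
  rewrite -[X in _ = _ * X]q1 /al /be !mulr_suml -sumrB mulr_sumr/=.
  by apply: eq_bigr => i _; field.
Qed.

(** If every branch had an opposite one of the same weight, then taking
    opposites would be an involution that exchanges the directions of an open
    half-plane (closed on half of its boundary) with the others, and enumerating
    these directions first and their opposites next would give the rearrangement
    of the definition of symmetry. *)
Lemma not_symmetric_branch {m} (gamma : 'I_m -> 'rV[R]_2) (c : 'I_m -> R) :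
  (forall i, gamma i != 0) -> injective gamma -> ~ star_symmetric gamma c ->
  exists i0, forall j, gamma j = - gamma i0 -> c j != c i0.
Proof.
move=> g0 gI; apply: contra_notP => noi.
have /choice [tau tauP] : forall i, exists j, gamma j = - gamma i /\ c j = c i.
  move=> i; apply: contrapT => h; apply: noi; exists i => j gj.
  by apply/eqP => cj; apply: h; exists j.
have tauK : involutive tau.
  by move=> i; apply: gI; rewrite (tauP _).1 (tauP _).1 opprK.
(* exactly one of v and - v is positive, for v != 0 *)
pose pos (v : 'rV[R]_2) := (0 < v 0 0) || (v 0 0 == 0) && (0 < v 0 1).
have posN v : v != 0 -> pos (- v) = ~~ pos v.
  move=> v0; rewrite /pos !mxE oppr_gt0 oppr_eq0 oppr_gt0.
  have [h|h|h]//= := ltgtP (v 0 0) 0.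
  have [h1|h1|h1]//= := ltgtP (v 0 1) 0.
  by move/eqP: v0; case; apply: rV2P; rewrite mxE.
pose H := finset (fun i => pos (gamma i)); pose k := #|H|.
have tauH i : (tau i \in H) = (i \notin H) by rewrite !inE (tauP i).1 posN.
have km : (k + k)%N = m.
  have tauI : injective tau by exact: inv_inj.
  have <- : (#|H| + #|~: H| = m)%N by rewrite cardsC card_ord.
  rewrite /k; congr (_ + _)%N; rewrite -(card_imset _ tauI); apply: eq_card => i.
  rewrite finset.in_setC; apply/imsetP/idP => [[j jH ->]|iH]; first by rewrite tauH negbK.
  by exists (tau i); rewrite ?tauK// tauH.
pose sf (i : 'I_m) : 'I_m := match fintype.split (cast_ord (esym km) i) with
  | inl a => enum_val a | inr a => tau (enum_val a) end.
have sfl a : sf (cast_ord km (lshift k a)) = enum_val a.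
  by rewrite /sf cast_ordK (unsplitK (inl a)).
have sfr a : sf (cast_ord km (rshift k a)) = tau (enum_val a).
  by rewrite /sf cast_ordK (unsplitK (inr a)).
have eH (a : 'I_k) : enum_val a \in H by exact: enum_valP.
have ksurj i : exists e, i = cast_ord km (unsplit e).
  by exists (fintype.split (cast_ord (esym km) i)); rewrite splitK cast_ordKV.
have sfI : injective sf.
  move=> i j; have [[a|a] ->] := ksurj i; have [[b|b] ->] := ksurj j; rewrite /= ?sfl ?sfr.
  - by move/enum_val_inj->.
  - by move=> h; have := eH a; rewrite h tauH eH.
  - by move=> h; have := eH b; rewrite -h tauH eH.
  - by move/(inv_inj tauK)/enum_val_inj->.
exists k, km, (perm sfI) => i; rewrite !permE sfl sfr; exact: tauP.
Qed.

Lemma symmetric_star_null {m} {gamma : 'I_m -> 'rV[R]_2} {c : 'I_m -> R} {h} :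
  star_symmetric gamma c -> (forall i, gamma i != 0) -> Cc h ->
  (forall i x, \int[mu]_t h (x + t *: gamma i) = 0) ->
  forall x, \sum_(i < m) c i * beam (gamma i) h x = 0.
Proof.
move=> [k [km [s sP]]] g0 ch h0 x.
have bij : bijective (fun a : 'I_(k + k) => s (cast_ord km a)).
  exists (fun i => cast_ord (esym km) ((s^-1)%g i)) => a.
    by rewrite permK cast_ordK.
  by rewrite cast_ordKV permKV.
rewrite (reindex _ (onW_bij _ bij)) big_split_ord/= -big_split/=; apply: big1 => a _.
by have [-> ->] := sP a; rewrite -mulrDr beam_opp// h0 mulr0.
Qed.

End StarTransform.

(** * The two directions of the theorem *)

Section Injectivity.
Context {R : realType}.
Implicit Types (v : 'rV[R]_2).

(** A factor [W (gamma i)] common to opposite branches does not affect their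
    cancellation, so that the condition on [c] is enough. *)
Lemma even_weight_slopes {m} {gamma : 'I_m -> 'rV[R]_2} {c : 'I_m -> R} {i0}
    (W : 'rV[R]_2 -> R) :
  (forall i, enorm (gamma i) = 1) -> injective gamma -> c i0 != 0 ->
  (forall j, gamma j = - gamma i0 -> c j != c i0) ->
  W (gamma i0) != 0 -> (forall v, W (- v) = W v) ->
  exists k : nat -> R, injective k /\ forall n,
    (forall i, gamma i 0 0 + k n * gamma i 0 1 != 0) /\
    \sum_(i < m) c i / (gamma i 0 0 + k n * gamma i 0 1) * W (gamma i) != 0.
Proof.
move=> g1 gI c0 opp W0 WN.
have w0 : c i0 * W (gamma i0) != 0 by rewrite mulf_neq0.
have [|k [kI kP]] := generic_slopes (w := fun i => c i * W (gamma i)) g1 gI w0.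
  by move=> j gj; rewrite gj WN (inj_eq (mulIf W0)) opp.
exists k; split=> // n; have [k1 k2] := kP n; split=> //.
by under eq_bigr do rewrite mulrAC.
Qed.

(** The two sums are the entries of the matrix of the system for the trace-free
    part; the double-angle functions do not vanish simultaneously at
    [gamma i0], and one nonzero entry is enough. *)
Lemma double_angle_slopes {m} {gamma : 'I_m -> 'rV[R]_2} {c : 'I_m -> R} {i0} :
  (forall i, enorm (gamma i) = 1) -> injective gamma -> c i0 != 0 ->
  (forall j, gamma j = - gamma i0 -> c j != c i0) ->
  exists k : nat -> R, [/\ injective k,
    forall n i, gamma i 0 0 + k n * gamma i 0 1 != 0 &
    forall n,
      (\sum_(i < m) c i / (gamma i 0 0 + k n * gamma i 0 1) *
         (gamma i 0 0 ^+ 2 - gamma i 0 1 ^+ 2)) ^+ 2 +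
      (\sum_(i < m) c i / (gamma i 0 0 + k n * gamma i 0 1) *
         (2 * gamma i 0 0 * gamma i 0 1)) ^+ 2 != 0].
Proof.
move=> g1 gI c0 opp; have n1 := enorm1 _ (g1 i0).
pose A (v : 'rV[R]_2) : R := v 0 0 ^+ 2 - v 0 1 ^+ 2.
pose B (v : 'rV[R]_2) : R := 2 * v 0 0 * v 0 1.
have [A0|A0] := eqVneq (A (gamma i0)) 0.
  have B0 : B (gamma i0) != 0.
    apply/eqP => B0; have : A (gamma i0) ^+ 2 + B (gamma i0) ^+ 2 = 1.
      by rewrite -[RHS](expr1n _ 2) -n1 /A /B; ring.
    by rewrite A0 B0 expr0n/= addr0 => /eqP; rewrite eq_sym oner_eq0.
  have [|k [kI kP]] := even_weight_slopes B g1 gI c0 opp B0.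
    by move=> v; rewrite /B !mxE; ring.
  exists k; split=> // n; first by have [] := kP n.
  have [_ k2] := kP n; rewrite gt_eqF// ltr_wpDl ?sqr_ge0// lt_neqAle sqr_ge0.
  by rewrite eq_sym expf_neq0.
have [|k [kI kP]] := even_weight_slopes A g1 gI c0 opp A0.
  by move=> v; rewrite /A !mxE; ring.
exists k; split=> // n; first by have [] := kP n.
have [_ k2] := kP n; rewrite gt_eqF// ltr_wpDr ?sqr_ge0// lt_neqAle sqr_ge0.
by rewrite eq_sym expf_neq0.
Qed.

Lemma rotation_system_eq0 (al be p q : R) : al ^+ 2 + be ^+ 2 != 0 ->
  al * p + be * q = 0 -> al * q - be * p = 0 -> p = 0 /\ q = 0.
Proof.
move=> n0 h1 h2; split; apply: (mulfI n0); rewrite mulr0.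
  transitivity (al * (al * p + be * q) - be * (al * q - be * p)); first by ring.
  by rewrite h1 h2; ring.
transitivity (be * (al * p + be * q) + al * (al * q - be * p)); first by ring.
by rewrite h1 h2; ring.
Qed.

Lemma radon_inj_comb (g : 'I_3 -> 'rV[R]_2 -> R) (a0 a1 a2 : R) (k : nat -> R) :
  (forall l, Cc (g l)) -> injective k ->
  (forall n s, a0 * lineproj (k n) (g 0) s + a1 * lineproj (k n) (g 1) s
             + a2 * lineproj (k n) (g 2) s = 0) ->
  forall x, a0 * g 0 x + a1 * g 1 x + a2 * g 2 x = 0.
Proof.
move=> Cg kI pk x; pose a (l : 'I_3) := [:: a0; a1; a2]`_l.
have e y : \sum_(l < 3) a l * g l y = a0 * g 0 y + a1 * g 1 y + a2 * g 2 y.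
  by rewrite sum3.
rewrite -e; apply: (radon_inj (G := fun y => \sum_(l < 3) a l * g l y) k) => //.
  exact: Cc_sum.
by move=> n s; rewrite lineproj_sum// sum3 pk.
Qed.

(** The trace [f11 + f22] and the trace-free part [(f11 - f22, f12)] of the
    difference of two fields with the same data are recovered separately, along
    different families of slopes. *)
Lemma not_symmetric_inj {m} {gamma : 'I_m -> 'rV[R]_2} {c : 'I_m -> R} {D} :
  (forall i, enorm (gamma i) = 1) -> injective gamma -> (forall i, c i != 0) ->
  ~ star_symmetric gamma c -> set_inj (C2c_S2 D) (star gamma c).
Proof.
move=> g1 gI c0 nsym f1 f2 /set_mem D1 /set_mem D2 eqf.
have gn0 i : gamma i != 0 by exact: enorm1_neq0.
have [i0 opp] := not_symmetric_branch gamma c gn0 gI nsym.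
pose g (l : 'I_3) (x : 'rV[R]_2) := f1 x 0 l - f2 x 0 l.
have Cg (l : 'I_3) : Cc (g l) by exact: CcB (C2c_Cc D1 l) (C2c_Cc D2 l).
have trace0 x : g 0 x + g 2 x = 0.
  have [k [kI kP]] := generic_slopes g1 gI (c0 i0) opp.
  rewrite -[LHS](_ : 1 * g 0 x + 0 * g 1 x + 1 * g 2 x = _); last by ring.
  apply: (radon_inj_comb g _ _ _ k Cg kI) => n s; have [k1 k2] := kP n.
  have [+ _ _] := star_eq_lineproj g1 D1 D2 eqf k1 s.
  move/eqP; rewrite mulf_eq0 (negbTE k2)/= => /eqP h.
  by rewrite !mul1r mul0r addr0.
have [k [kI k1 kP]] := double_angle_slopes g1 gI (c0 i0) opp.
have pq0 n s : lineproj (k n) (g 0) s - lineproj (k n) (g 2) s = 0 /\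
    lineproj (k n) (g 1) s = 0.
  have [_ h1 h2] := star_eq_lineproj g1 D1 D2 eqf (k1 n) s.
  exact: rotation_system_eq0 (kP n) h1 h2.
have diff0 x : g 0 x - g 2 x = 0.
  rewrite -[LHS](_ : 1 * g 0 x + 0 * g 1 x + -1 * g 2 x = _); last by ring.
  apply: (radon_inj_comb g _ _ _ k Cg kI) => n s.
  by have [h _] := pq0 n s; rewrite mul1r mul0r addr0 mulN1r.
have off0 x : g 1 x = 0.
  rewrite -[LHS](_ : 0 * g 0 x + 1 * g 1 x + 0 * g 2 x = _); last by ring.
  apply: (radon_inj_comb g _ _ _ k Cg kI) => n s.
  by have [_ h] := pq0 n s; rewrite !mul0r h mulr0 !addr0.
apply/funext => x; apply/rowP => j; apply/eqP; rewrite -subr_eq0; apply/eqP.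
have h1 := trace0 x; have h2 := diff0 x.
have z0 : g 0 x = 0 by lra.
have z2 : g 2 x = 0 by lra.
rewrite -/(g j x); case: j => [[|[|[|//]]] jlt].
- by rewrite (_ : Ordinal jlt = 0)//; exact: val_inj.
- by rewrite (_ : Ordinal jlt = 1)//; exact: val_inj.
- by rewrite (_ : Ordinal jlt = 2)//; exact: val_inj.
Qed.

Lemma compactly_supported_disc {r : R} {h : 'rV[R]_2 -> R} : 0 < r ->
  supp_in (r / 2) h -> compactly_supported_in (disc r) h.
Proof.
move=> r_gt0 sh; have r20 : 0 < r / 2 by rewrite divr_gt0.
have Sh : closure [set x | h x != 0] `<=` [set x | `|x| <= r / 2].
  rewrite closureE; apply: smallest_sub; last first.
    by move=> y /= hy; rewrite leNgt; apply: contra hy => /sh->.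
  rewrite (_ : [set x | _] = Num.norm @^-1` [set x | x <= r / 2])//.
  by apply: closed_comp; [move=> y _; exact: norm_continuous|exact: closed_le].
split.
  apply: bounded_closed_compact; last exact: closed_closure.
  exists (r / 2); split; first exact: num_real.
  by move=> M rM y /Sh/= /le_trans; apply; exact: ltW.
(* the sup norm is at most r / 2, so the squared Euclidean norm is at most
   r ^ 2 / 2 *)
move=> y /Sh/= yr; rewrite /disc/= /enorm dotv2E.
rewrite -[ltRHS](gtr0_norm r_gt0) -sqrtr_sqr ltr_sqrt ?exprn_gt0//.
have sq j : y 0 j ^+ 2 <= (r / 2) ^+ 2.
  rewrite -[leLHS]real_normK ?num_real// ler_pXn2r ?nnegrE ?(ltW r20)//.
  exact: le_trans (coord_le_norm _ _ _) yr.
have := sq 0; have := sq 1; have := exprn_gt0 2 r_gt0; lra.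
Qed.

(** A multiple [h] of the identity tensor has entries [h], 0, [h] in every
    rotated frame, so that its star transform only involves the scalar sums that
    vanish when [h] has zero integral along all branch lines. *)
Lemma symmetric_not_inj {m} {gamma : 'I_m -> 'rV[R]_2} {c : 'I_m -> R} {r : R} :
  0 < r -> (forall i, enorm (gamma i) = 1) -> star_symmetric gamma c ->
  ~ set_inj (C2c_S2 (disc r)) (star gamma c).
Proof.
move=> r_gt0 g1 sym inj; have gn0 i : gamma i != 0 by exact: enorm1_neq0.
have r20 : 0 < r / 2 by rewrite divr_gt0.
have [|h [ch sh [x hx] h0]] := exists_null_lines (codom gamma) _ r20.
  by move=> v /codomP[i ->].
have Ch : Cc h by exists (r / 2); split=> //; exact: Ck_cont ch.
pose f e (y : 'rV[R]_2) := vec3 (e * h y) 0 (e * h y).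
have fE e j y : f e y 0 j = ([:: e; 0; e]`_j : R) * h y.
  by rewrite mxE; case: j => [[|[|[|]]]]//= _; rewrite mul0r.
have Df e : C2c_S2 (disc r) (f e).
  move=> j; under eq_fun do rewrite fE; split; first exact: CkZ.
  by apply: compactly_supported_disc => // y /sh->; rewrite mulr0.
have null e x' : \sum_(i < m) c i * beam (gamma i) (fun y => e * h y) x' = 0.
  apply: symmetric_star_null => //; first exact: CcZ.
  move=> i x''; rewrite RintegralZl//; first by rewrite h0 ?mulr0// codom_f.
  exact: (Cc_integrable _ _ (Cc_line _ _ (gn0 i) Ch)).
have f0 e : star gamma c (f e) = fun=> 0.
  apply/funext => x'; apply/rowP => j; rewrite star_entry mxE -[RHS](null ([:: e; 0; e]`_j) x').
  apply: eq_bigr => i _; congr (_ * beam _ _ _); apply/funext => y.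
  rewrite /dotv sum3 !mxE/= /frame_tensor; have n1 := enorm1 _ (g1 i).
  case: j => [[|[|[|//]]] jlt]; rewrite /= !mxE/=.
  - by rewrite -[RHS]mul1r -n1; ring.
  - by ring.
  - by rewrite -[RHS]mul1r -n1; ring.
have := inj (f 1) (f 0); rewrite !inE !f0 => /(_ (Df 1) (Df 0) erefl).
move/(congr1 (fun F : 'rV[R]_2 -> 'rV[R]_3 => F x 0 0)).
by rewrite !mxE/= mul1r mul0r => /eqP; rewrite (negbTE hx).
Qed.

End Injectivity.

Theorem theorem12 (R : realType) (r : R) (r_gt0 : 0 < r)
    (m : nat) (m_gt0 : (0 < m)%N)
    (gamma : 'I_m -> 'rV[R]_2) (c : 'I_m -> R)
    (gamma_unit : forall i, enorm (gamma i) = 1)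
    (gamma_inj : injective gamma)
    (c_neq0 : forall i, c i != 0) :
  set_inj (C2c_S2 (disc r)) (star gamma c) <-> ~ star_symmetric gamma c.
Proof.
split=> [inj sym|]; first exact: symmetric_not_inj r_gt0 gamma_unit sym inj.
exact: not_symmetric_inj.
Qed.
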